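(* Let $1<\gamma<2$, $0\le\delta\le 1$, $T>0$, $c,x,y\in\mathbb{R}$, and let $\eta\in J^{\delta(2-\gamma)}(L^{1})$, i.e. $\eta(t)=J_t^{\delta(2-\gamma)}\phi(t)$ for some $\phi\in L^1((0,T),\mathbb{R})$. Then $$\omega(t)=t^{\gamma+\delta(2-\gamma)-2}E_{\gamma,\gamma+\delta(2-\gamma)-1}(ct^{\gamma})\,x+t^{\gamma+\delta(2-\gamma)-1}E_{\gamma,\gamma+\delta(2-\gamma)}(ct^{\gamma})\,y+\int_{0}^{t}(t-s)^{\gamma-1}E_{\gamma,\gamma}(c(t-s)^{\gamma})\eta(s)\,ds$$ is a solution of the problem $$D_{0}^{\gamma,\delta}\omega(t)=c\,\omega(t)+\eta(t)\quad\text{for a.e. } t\in(0,T],$$ $$(g_{(1-\delta)(2-\gamma)}*\omega)(0)=x,\qquad (g_{(1-\delta)(2-\gamma)}*\omega)'(0)=y.$$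
   Context: For $\alpha>0$, $J_t^{\alpha}\omega(t)=\frac{1}{\Gamma(\alpha)}\int_0^t(t-s)^{\alpha-1}\omega(s)\,ds$ is the Riemann-Liouville fractional integral, and $J_t^0$ is the identity. For $1<\gamma<2$ and $0\le\delta\le1$ the Hilfer fractional derivative of order $\gamma$ and type $\delta$ is $D_0^{\gamma,\delta}\omega(t)=J_t^{\delta(2-\gamma)}\frac{d^2}{dt^2}J_t^{(1-\delta)(2-\gamma)}\omega(t)$, $t>0$. Here $g_\alpha(t)=t^{\alpha-1}/\Gamma(\alpha)$ for $\alpha>0$, so $g_\alpha*\omega=J_t^\alpha\omega$, with the convention $g_0*\omega=\omega$. Values at $0$ in the initial conditions are understood as limits as $t\to0+$. A solution is a function satisfying the equation and the initial conditions. Since $\eta$ is given only as an element of $L^1$, the second derivative in the Hilfer derivative and the equation are understood almost everywhere. $E_{\alpha,\beta}(z)=\sum_{k=0}^\infty \frac{z^k}{\Gamma(\alpha k+\beta)}$ is the two-parameter Mittag-Leffler function. *)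

(* Defs.v *)
From HB Require Import structures.
From mathcomp Require Import all_boot all_order all_algebra.
From mathcomp Require Import all_classical all_reals all_analysis.

Set Implicit Arguments.
Unset Strict Implicit.
Unset Printing Implicit Defensive.

Import Order.TTheory GRing.Theory Num.Theory.
Import numFieldNormedType.Exports.

Local Open Scope classical_set_scope.
Local Open Scope ring_scope.

(* Euler's integral; meaningful for 0 < a. *)
Definition Gamma (R : realType) (a : R) : R :=
  \int[lebesgue_measure]_(s in `]0, +oo[) (s `^ (a - 1) * expR (- s)).

Definition mittag_leffler (R : realType) (a b z : R) : R :=
  limn (series (fun k : nat => z ^+ k / Gamma (a * k%:R + b))).

(* J^a f (t) = (g_a * f)(t), with J^0 the identity. The Lebesgue integral of a
   non-integrable function has a junk value: frac_int_ex says that the integral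
   converges. *)
Definition frac_int (R : realType) (a : R) (f : R -> R) (t : R) : R :=
  if a == 0 then f t
  else (Gamma a)^-1 *
       \int[lebesgue_measure]_(s in `]0, t[) ((t - s) `^ (a - 1) * f s).

Definition frac_int_ex (R : realType) (a : R) (f : R -> R) (t : R) : Prop :=
  a != 0 ->
  lebesgue_measure.-integrable `]0, t[
    (fun s => ((t - s) `^ (a - 1) * f s)%:E).

Definition L1 (R : realType) (T : R) (f : R -> R) : Prop :=
  lebesgue_measure.-integrable `]0, T[ (fun s => (f s)%:E).

(* f is a measurable representative of an element of J^a (L^1(0, T)). *)
Definition frac_int_range (R : realType) (a T : R) (f : R -> R) : Prop :=
  measurable_fun `]0, T[ f /\
  exists2 phi : R -> R, L1 T phi &
    {ae lebesgue_measure, forall t, 0 < t < T -> f t = frac_int a phi t}.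

Definition hilfer_deriv (R : realType) (g d : R) (w : R -> R) : R -> R :=
  frac_int (d * (2 - g)) ((frac_int ((1 - d) * (2 - g)) w)^`(2))%classic.

(* derive1 is total, so each derivative comes with the assertion that it exists
   (everywhere for the first one, almost everywhere for the second one). *)
Record is_solution (R : realType) (g d T c x y : R) (eta w : R -> R) : Prop :=
  IsSolution {
    solution_frac_int : forall t, 0 < t < T ->
      frac_int_ex ((1 - d) * (2 - g)) w t;
    solution_derivable : forall t, 0 < t < T ->
      derivable (frac_int ((1 - d) * (2 - g)) w) t 1;
    solution_hilfer : {ae lebesgue_measure, forall t, 0 < t <= T ->
      derivable ((frac_int ((1 - d) * (2 - g)) w)^`())%classic t 1 /\
      frac_int_ex (d * (2 - g)) ((frac_int ((1 - d) * (2 - g)) w)^`(2))%classic t};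
    solution_eq : {ae lebesgue_measure, forall t, 0 < t <= T ->
      hilfer_deriv g d w t = c * w t + eta t};
    solution_init0 :
      frac_int ((1 - d) * (2 - g)) w t @[t --> 0^'+] --> x;
    solution_init1 :
      ((frac_int ((1 - d) * (2 - g)) w)^`())%classic t @[t --> 0^'+] --> y
  }.

(* Main.v *)
(* Write g_a(t) = t^(a-1) / Gamma(a) for t > 0 and g_a(t) = 0 for t <= 0, and
   e_b = \sum_k c^k g_(gamma k + b), so that e_b(t) = t^(b-1) E_(gamma,b)(c t^gamma)
   for t > 0 and e_b = g_b + c e_(gamma+b).  The beta integral gives
   g_a * g_b = g_(a+b), hence g_a * e_b = e_(a+b).  Once functions are extended by
   zero, fractional integrals are convolutions on the line, associative by Fubini.
   Let b = delta (2 - gamma), a = (1 - delta) (2 - gamma) and eta = g_b * phi.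
   With m = gamma + b - 1 = 1 - a, the claimed solution is
   w = x e_m + y e_(m+1) + e_(m+1) * phi, hence
   u = g_a * w = x e_1 + y e_2 + e_2 * phi = x + y t + g_2 * chi, where
   chi = phi + c (x e_(gamma-1) + y e_gamma + e_gamma * phi) is locally integrable.
   Therefore u' = y + g_1 * chi everywhere, u'' = chi almost everywhere by Lebesgue's
   differentiation theorem, and g_b * chi = eta + c w.  No regularity of E beyond
   measurability is needed. *)
Require Import Defs.
From HB Require Import structures.
From mathcomp Require Import all_boot all_order all_algebra.
From mathcomp Require Import all_classical all_reals all_analysis.
From mathcomp Require Import measurable_realfun ring lra.

Import Order.TTheory GRing.Theory Num.Theory.
Import numFieldNormedType.Exports.

Local Open Scope classical_set_scope.
Local Open Scope ring_scope.

(** The obstacle is existence rather than the algebra of kernels. Integrals, limits and derivatives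
    are total functions, so each identity must come with convergence, and [phi] is only $L^1$. Signs
    are handled by domination: with $|c|$ in place of $c$ the series $e_b$ has nonnegative terms,
    which allows termwise integration, and it dominates the signed series. Fubini for the triple
    integrals rests on one threshold: for $c\ge0$ and $b\ge1$ the kernel $e_b$ is nondecreasing,
    hence bounded to the left of each $t$, and its convolution with [phi] exists at every point. All
    convolutions with [phi] inside u, u' and w have order at least 1, whereas $g_b*\phi$ with
    $0<b<1$ exists only almost everywhere; so the equation is reached only almost everywhere. A
    second obstacle is that u'' is a total derivative which agrees with $\chi$ off a null set and
    stands under the outer fractional integral. It has to be measurable on its own, which is deduced
    from continuity of $g_1*\chi$. The values $\delta=0$ and $\delta=1$ turn one of the two
    fractional integrals into the identity and form separate cases throughout. *)

(** * Affine changes of variable in Lebesgue integrals *)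

Section change_of_variable.
Context {R : realType}.
Local Notation mu := (@lebesgue_measure R).
Local Open Scope ereal_scope.

Lemma measurable_affine (k c : R) :
  measurable_fun setT (fun x : R => (k * x + c)%R : measurableTypeR R).
Proof. by apply: measurable_funD => //; exact: measurable_funM. Qed.

Lemma ge0_integral_affine (k c : R) (f : R -> \bar R) : (0 < k)%R ->
  measurable_fun setT f -> (forall x, 0 <= f x) ->
  \int[mu]_x f x = k%:E * \int[mu]_x f (k * x + c)%R.
Proof.
move=> k0 mf f0.
pose phi : measurableTypeR R -> measurableTypeR R := fun x => (k * x + c)%R.
have mphi : measurable_fun setT phi by exact: measurable_affine.
have [nu nuE] : exists nu : {measure set (measurableTypeR R) -> \bar R},
    forall A, nu A = mu (phi @^-1` A).
  by unshelve eexists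
    (measure_function_pushforward__canonical__measure_function_Measure mu mphi).
pose kn := NngNum (ltW k0).
have muE A : measurable A -> mu A = mscale kn nu A.
  apply: lebesgue_measure_unique => _ [[a b]] _ <-.
  transitivity (k%:E * nu `]a, b]%classic); last by [].
  rewrite nuE.
  have -> : phi @^-1` `]a, b] = `]((a - c) / k)%R, ((b - c) / k)%R]%classic.
    apply/seteqP; split=> x; by rewrite /= !in_itv/= /phi
        ltr_pdivrMr// ler_pdivlMr// ltrBlDr lerBrDr (mulrC x).
  rewrite !lebesgue_measure_itv/= !lte_fin ltr_pM2r ?invr_gt0// ltrD2r.
  case: ifPn => _; last by rewrite mule0.
  by rewrite -!EFinB -EFinM; congr EFin; field; rewrite gt_eqF.
transitivity (\int[mscale kn nu]_x f x).
  by apply: eq_measure_integral => A mA _; exact: muE.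
rewrite ge0_integral_mscale//=; congr (_ * _).
transitivity (\int[pushforward mu phi]_x f x).
  by apply: eq_measure_integral => A mA _; rewrite nuE.
by rewrite ge0_integral_pushforward.
Qed.

Lemma ge0_integralN (f : R -> \bar R) :
  measurable_fun setT f -> (forall x, 0 <= f x) ->
  \int[mu]_x f x = \int[mu]_x f (- x)%R.
Proof.
move=> mf f0.
transitivity (\int[pushforward mu (-%R : R -> measurableTypeR R)]_x f x).
  apply: eq_measure_integral => A mA _.
  exact/esym/lebesgue_measureN.
by rewrite ge0_integral_pushforward.
Qed.

Lemma integralN (f : R -> \bar R) : measurable_fun setT f ->
  \int[mu]_x f x = \int[mu]_x f (- x)%R.
Proof.
move=> mf; rewrite [LHS]integralE [RHS]integralE.
congr (_ - _).
  rewrite ge0_integralN//; last exact: measurable_funepos.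
  by apply: eq_integral => x _; rewrite !funeposE.
rewrite ge0_integralN//; last exact: measurable_funeneg.
by apply: eq_integral => x _; rewrite !funenegE.
Qed.

Lemma integral_shift (c : R) (f : R -> \bar R) : measurable_fun setT f ->
  \int[mu]_x f x = \int[mu]_x f (x + c)%R.
Proof.
have shift g : measurable_fun setT g -> (forall x, 0 <= g x) ->
    \int[mu]_x g x = \int[mu]_x g (x + c)%R.
  move=> mg g0; rewrite (ge0_integral_affine 1%R c)// mul1e.
  by apply: eq_integral => x _; rewrite mul1r.
move=> mf; rewrite [LHS]integralE [RHS]integralE.
congr (_ - _).
  rewrite shift//; last exact: measurable_funepos.
  by apply: eq_integral => x _; rewrite !funeposE.
rewrite shift//; last exact: measurable_funeneg.
by apply: eq_integral => x _; rewrite !funenegE.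
Qed.

Lemma integral_reflection (c : R) (f : R -> \bar R) : measurable_fun setT f ->
  \int[mu]_x f x = \int[mu]_x f (c - x)%R.
Proof.
move=> mf; rewrite (integral_shift c)// integralN.
  by apply: eq_integral => x _; rewrite addrC.
apply: (measurableT_comp mf); exact: measurable_funD.
Qed.

End change_of_variable.

(** * Integrability of powers at the origin *)

Section powR_integral.
Context {R : realType}.
Local Notation mu := (@lebesgue_measure R).

Lemma continuous_powR_gt0 (p x : R) : 0 < x ->
  {for x, continuous (fun s : R => s `^ p)}.
Proof.
move=> x0; apply/differentiable_continuous/derivable1_diffP.
by case: (is_derive1_powR p x0).
Qed.

Lemma integral_powR_segment (a e : R) : 0 < a -> 0 < e < 1 ->
  (\int[mu]_(s in `[e, 1%R]) (s `^ (a - 1))%:E <= (a^-1)%:E)%E.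
Proof.
move=> a0 /andP[e0 e1].
rewrite (@continuous_FTC2 _ _ (fun s => a^-1 * s `^ a))//.
- rewrite -EFinB lee_fin powR1 mulr1 gerBl mulr_ge0 ?invr_ge0 ?powR_ge0//.
  exact: ltW.
- apply: continuous_in_subspaceT => x; rewrite inE/= in_itv/= => /andP[ex _].
  by apply: continuous_powR_gt0; exact: lt_le_trans ex.
- have cF x : 0 < x -> {for x, continuous (fun s : R => a^-1 * s `^ a)}.
    by move=> x0; apply: cvgMl_tmp; exact: continuous_powR_gt0.
  split.
  + move=> x; rewrite in_itv/= => /andP[ex _].
    by apply: derivableM => //; apply: derivable_powR;
      rewrite in_itv/= (lt_trans e0 ex).
  + by apply: cvg_at_right_filter; exact: cF.
  + by apply: cvg_at_left_filter; exact: cF.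
- move=> x; rewrite in_itv/= => /andP[ex _].
  have x0 := lt_trans e0 ex.
  have [dx dxE] := is_derive1_powR a x0.
  rewrite derive1E deriveM// derive_cst scaler0 addr0 dxE /GRing.scale/=.
  by rewrite mulrA mulVf ?mul1r// gt_eqF.
Qed.

(** For [a < 1] the integrand is unbounded at 0, so the antiderivative is used on segments only and
    the bound, uniform in [n], passes to the limit by monotone convergence. The lower ends
    [1 / (n + 2)] stay strictly below 1. *)
Lemma integral_powR_near0 (a : R) : 0 < a ->
  (\int[mu]_(s in `]0%R, 1%R]) (s `^ (a - 1))%:E <= (a^-1)%:E)%E.
Proof.
move=> a0; pose F n : set (measurableTypeR R) := `[n.+2%:R^-1, 1]%classic.
have FE : \bigcup_n F n = `]0, 1]%classic.
  apply/seteqP; split=> x /=.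
    move=> [n _]; rewrite /F/= !in_itv/= => /andP[nx ->]; rewrite andbT.
    by apply: lt_le_trans nx; rewrite invr_gt0.
  rewrite in_itv/= => /andP[x0 x1].
  have [n _ nx] := near_infty_natSinv_lt (PosNum x0).
  have {nx} := nx n.+1 => /(_ (leqnSn _))/= nx.
  by exists n => //; rewrite /F/= in_itv/= x1 (ltW nx).
have mp : measurable_fun setT (fun s : R => (s `^ (a - 1))%:E).
  by apply/measurable_EFinP; exact: measurable_powR.
rewrite -FE; have h := @ge0_nondecreasing_set_cvg_integral _ _ _ F
  (fun s => (s `^ (a - 1))%:E) mu.
apply: (cvge_to_le (h _ _ _ _)).
- apply/nondecreasing_seqP => n; rewrite subsetEset => x.
  rewrite /F/= !in_itv/= => /andP[nx ->]; rewrite andbT (le_trans _ nx)//.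
  by rewrite lef_pV2 ?posrE// ler_nat.
- by move=> n; exact: measurable_itv.
- by move=> n; exact: measurable_funTS.
- by move=> n x _; rewrite lee_fin powR_ge0.
apply: nearW => n; apply: integral_powR_segment => //.
by rewrite invr_gt0 ltr0n invf_lt1 ?ltr1n.
Qed.

End powR_integral.

(** * Convergence, positivity and lower bounds of Euler's integral *)

Section gamma_function.
Context {R : realType}.
Local Notation mu := (@lebesgue_measure R).

(** The kernel $g_a$ without its factor $1/\Gamma(a)$, in which Euler's integral and the beta
    integral are computed; [rlker] is the normalised kernel. *)
Definition pker (a : R) : R -> R := (fun s => s `^ (a - 1)) \_ `]0, +oo[.

Lemma pkerE a s : 0 < s -> pker a s = s `^ (a - 1).
Proof. by move=> s0; rewrite /pker patchE mem_set//= in_itv/= s0. Qed.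

Lemma pker_le0 a s : s <= 0 -> pker a s = 0.
Proof.
by move=> s0; rewrite /pker patchE memNset//= in_itv/= andbT; apply/negP; rewrite -leNgt.
Qed.

Lemma pker_ge0 a s : 0 <= pker a s.
Proof.
by have [/pker_le0->//|/pkerE->] := leP s 0; rewrite powR_ge0.
Qed.

Lemma measurable_pker a : measurable_fun setT (pker a).
Proof.
apply/measurable_restrict => //; apply: measurable_funTS; exact: measurable_powR.
Qed.

Let gker a (s : R) : \bar R := (pker a s * expR (- s))%:E.

Lemma measurable_gker a : measurable_fun setT (gker a).
Proof.
apply/measurable_EFinP; apply: measurable_funM; first exact: measurable_pker.
by apply: measurableT_comp => //; exact: measurable_expR.
Qed.

Lemma gker_ge0 a s : (0 <= gker a s)%E.
Proof. by rewrite lee_fin mulr_ge0 ?pker_ge0 ?expR_ge0. Qed.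

Let near0 a := (fun s : R => s `^ (a - 1)) \_ `]0, 1].

Let near0_ge0 a s : 0 <= near0 a s.
Proof. by apply: restrict_ge0 => {}s _; exact: powR_ge0. Qed.

(** On []0, 1]] the exponential is at most 1; beyond 1 the power is absorbed by $e^{s/2}$, which
    leaves a multiple of $e^{-s/2}$, that is, of an exponential density of known integral. *)
Lemma gker_le (a : R) : exists2 C : R, 0 <= C & forall s : R,
  (gker a s <= (near0 a s)%:E + (C * exponential_pdf 2^-1 s)%:E)%E.
Proof.
have [n an] : exists n : nat, a - 1 <= n%:R.
  exists (Num.Def.archi_bound (a - 1)).
  have [a1|a1] := leP 0 (a - 1); first exact/ltW/archi_boundP.
  by rewrite (le_trans (ltW a1)).
(* One term of the exponential series gives $s^{n+1}\le 2^{n+1}(n+1)!\,e^{s/2}$; the extra factor 2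
   cancels the rate $1/2$ in front of the density. *)
exists (2 * 2 ^+ n.+1 * n.+1`!%:R) => [|s].
  by rewrite !mulr_ge0// exprn_ge0.
rewrite /gker -EFinD lee_fin.
have p0 : 0 <= exponential_pdf 2^-1 s by exact: exponential_pdf_ge0.
have [s0|s0] := leP s 0.
  rewrite pker_le0// mul0r addr_ge0//.
  by rewrite !mulr_ge0// exprn_ge0.
rewrite pkerE//; have [s1|s1] := leP s 1.
  rewrite /near0 patchE mem_set/= ?in_itv/= ?s0// -[leLHS]addr0 lerD//.
    by rewrite ler_piMr ?powR_ge0// -expR0 ler_expR oppr_le0 ltW.
  by rewrite !mulr_ge0// exprn_ge0.
rewrite /near0 patchE memNset/=; last by rewrite in_itv/= s0/=; apply/negP; rewrite -ltNge.
rewrite add0r exponential_pdfE ?(ltW s0)//.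
apply: (@le_trans _ _ (2 ^+ n.+1 * n.+1`!%:R * expR (2^-1 * s) * expR (- s))); last first.
  rewrite -[leLHS]mulrA -expRD (_ : 2^-1 * s + - s = - 2^-1 * s); last by field.
  by rewrite le_eqVlt; apply/orP; left; apply/eqP; field.
rewrite ler_wpM2r ?expR_ge0//.
apply: (@le_trans _ _ (s ^+ n.+1)).
  rewrite -powR_mulrn ?(ltW s0)// ler_powR// ?(ltW s1)//.
  by rewrite (le_trans an)// ler_nat.
have s2 : 0 <= 2^-1 * s by rewrite mulr_ge0// ltW.
have := expR_ge1Dxn n s2.
rewrite -(ler_pM2l (_ : 0 < 2 ^+ n.+1 * n.+1`!%:R)); last first.
  by rewrite mulr_gt0 ?exprn_gt0// ltr0n fact_gt0.
apply: le_trans; rewrite exprMn mulrDr.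
rewrite [X in _ <= _ + X](_ : _ = s ^+ n.+1); last first.
  rewrite exprVn; field; rewrite expf_neq0//=.
  by rewrite pnatr_eq0 -lt0n fact_gt0.
by rewrite lerDr mulr1 mulr_ge0 ?exprn_ge0.
Qed.

Lemma gamma_integral_lty (a : R) : 0 < a -> (\int[mu]_s gker a s < +oo)%E.
Proof.
move=> a0; have [C C0 gC] := gker_le a.
have m1 : measurable_fun setT
    (fun s : R => (near0 a s)%:E).
  apply/measurable_EFinP/measurable_restrict => //; apply: measurable_funTS.
  exact: measurable_powR.
have m2 : measurable_fun setT (fun s : R => (C * exponential_pdf 2^-1 s)%:E).
  apply/measurable_EFinP; apply: measurable_funM => //.
  exact: measurable_exponential_pdf.
apply: (@le_lt_trans _ _ (\int[mu]_s ((near0 a s)%:E +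
    (C * exponential_pdf 2^-1 s)%:E))%E).
  apply: ge0_le_integral => //.
  - by move=> s _; exact: gker_ge0.
  - exact: measurable_gker.
  - exact: emeasurable_funD.
rewrite ge0_integralD//; last 2 first.
- by move=> s _; rewrite lee_fin near0_ge0.
- by move=> s _; rewrite lee_fin mulr_ge0// exponential_pdf_ge0.
rewrite lte_add_pinfty//.
  under eq_integral do rewrite -[(_ _)%:E]/((EFin \o near0 a) _).
  rewrite -restrict_EFin -integral_mkcond.
  by rewrite (le_lt_trans (integral_powR_near0 a a0))// ltry.
under eq_integral do rewrite EFinM.
rewrite ge0_integralZl//.
- by rewrite integral_exponential_pdf// mule1 ltry.
- by apply/measurable_EFinP; exact: measurable_exponential_pdf.
- by move=> s _; rewrite lee_fin exponential_pdf_ge0.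
Qed.

Lemma GammaE (a : R) : 0 < a -> (Gamma a)%:E = (\int[mu]_s gker a s)%E.
Proof.
move=> a0; rewrite /Gamma Rintegral_mkcond -[RHS]fineK; last first.
  rewrite ge0_fin_numE ?gamma_integral_lty//.
  by apply: integral_ge0 => s _; exact: gker_ge0.
congr (fine _)%:E; apply: eq_integral.
move=> s _; rewrite /gker/= patchE; case: ifPn => s0.
  by rewrite pkerE//; move: s0; rewrite inE/= in_itv/= andbT.
rewrite pker_le0 ?mul0r//; move: s0; rewrite notin_setE/= in_itv/= andbT => /negP.
by rewrite -leNgt.
Qed.

(** Only the part of Euler's integral over [[M, M + 1]] is kept. Since [M] is free, this shows later
    that Gamma outgrows every geometric sequence. *)
Lemma Gamma_ge (a M k : R) : 0 < a -> 0 < M -> 0 <= k ->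
  (forall s, M <= s <= M + 1 -> k <= s `^ (a - 1)) ->
  k * expR (- (M + 1)) <= Gamma a.
Proof.
move=> a0 M0 k0 kM; rewrite -lee_fin GammaE//.
pose I : set (measurableTypeR R) := `[M, M + 1]%classic.
apply: (@le_trans _ _ (\int[mu]_(s in I) gker a s)%E); last first.
  apply: ge0_subset_integral => //.
  - exact: measurable_itv.
  - exact: measurable_gker.
  - by move=> s _; exact: gker_ge0.
apply: (@le_trans _ _ (\int[mu]_(s in I) (k * expR (- (M + 1)))%:E)%E).
  rewrite integral_cst; last exact: measurable_itv.
  rewrite /I/= lebesgue_measure_itv/= lte_fin ltrDl ltr01.
  by rewrite -EFinB addrAC subrr add0r mule1.
apply: ge0_le_integral => //=.
- exact: measurable_itv.
- by move=> s _; rewrite lee_fin mulr_ge0// expR_ge0.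
- by apply: measurable_funTS; exact: measurable_gker.
- move=> s; rewrite /I/= in_itv/= => /andP[Ms sM].
  rewrite /gker lee_fin pkerE ?(lt_le_trans M0)//.
  by rewrite ler_pM ?expR_ge0 ?kM ?Ms// ler_expR lerN2.
Qed.

Lemma Gamma_gt0 (a : R) : 0 < a -> 0 < Gamma a.
Proof.
move=> a0; have [k k0 kP] : exists2 k : R, 0 < k &
    forall s : R, 1 <= s <= 1 + 1 -> k <= s `^ (a - 1).
  (* On [[1, 2]] a power with nonnegative exponent is at least 1, and one with negative exponent is
     at least its value at 2; the minimum covers both. *)
  exists (2 `^ (Num.min 0 (a - 1))); first by rewrite powR_gt0.
  move=> s /andP[s1 s2]; have s0 : 0 < s by exact: lt_le_trans s1.
  have [a1|a1] := leP 0 (a - 1).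
    by rewrite powRr0 -[leLHS](powRr0 s) ler_powR.
  rewrite -(opprK (a - 1)) [leLHS]powRN [leRHS]powRN lef_pV2 ?posrE ?powR_gt0//.
  by apply: ge0_ler_powR; rewrite ?nnegrE ?oppr_ge0 ?(ltW a1) ?(ltW s0).
apply: lt_le_trans (Gamma_ge a 1 k a0 ltr01 (ltW k0) kP).
by rewrite mulr_gt0// expR_gt0.
Qed.

End gamma_function.

(** * The beta integral and the semigroup law of the kernels *)

Section beta.
Context {R : realType}.
Local Notation mu := (@lebesgue_measure R).

Lemma measurable_diff2 (f : R -> R) : measurable_fun setT f ->
  measurable_fun setT (fun p : R * R => f (p.1 - p.2)).
Proof. by move=> mf; apply: measurableT_comp => //; exact: measurable_funB. Qed.

Lemma tonelli (F : R -> R -> \bar R) :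
  measurable_fun setT (fun p : R * R => F p.1 p.2) ->
  (forall x y, 0 <= F x y)%E ->
  (\int[mu]_x \int[mu]_y F x y = \int[mu]_y \int[mu]_x F x y)%E.
Proof.
move=> mF F0.
exact: (@fubini_tonelli _ _ (measurableTypeR R) (measurableTypeR R) R mu mu
  (fun p => F p.1 p.2) mF (fun p => F0 p.1 p.2)).
Qed.

Lemma pkerZ (a k s : R) : 0 < k -> pker a (k * s) = k `^ (a - 1) * pker a s.
Proof.
move=> k0; have [s0|s0] := leP s 0.
  by rewrite !pker_le0 ?mulr0// pmulr_rle0.
by rewrite !pkerE ?mulr_gt0// powRM// ltW.
Qed.

(** Under the substitution of $ts$ for $s$ the two kernels contribute the exponents $a-1$ and $b-1$,
    and the differential contributes 1. *)
Lemma pker_conv_scale (a b t : R) : 0 < t ->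
  (\int[mu]_s (pker a (t - s) * pker b s)%:E =
   (t `^ (a + b - 1))%:E * \int[mu]_s (pker a (1 - s) * pker b s)%:E)%E.
Proof.
move=> t0.
have mab (v : R) : measurable_fun setT (fun s : R => (pker a (v - s) * pker b s)%:E).
  apply/measurable_EFinP; apply: measurable_funM; last exact: measurable_pker.
  by apply: measurableT_comp; [exact: measurable_pker|exact: measurable_funB].
rewrite (ge0_integral_affine t 0 _ t0 (mab t)); last first.
  by move=> s; rewrite lee_fin mulr_ge0 ?pker_ge0.
under eq_integral => s _.
  rewrite addr0 -[X in X - _]mulr1 -mulrBr !pkerZ// mulrACA EFinM.
  over.
rewrite ge0_integralZl//; last 3 first.
- exact: mab.
- by move=> s _; rewrite lee_fin mulr_ge0 ?pker_ge0.
- by rewrite lee_fin mulr_ge0 ?powR_ge0.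
rewrite muleA -EFinM -powRD; last by rewrite (gt_eqF t0) implybT.
rewrite -[X in X * _ `^ _](powRr1 (ltW t0)) -powRD; last by rewrite (gt_eqF t0) implybT.
by congr ((_ `^ _)%:E * _)%E; ring.
Qed.

(** The function [F] is integrated over the plane in both orders. Integrating in [s] first, scaling
    gives $\Gamma(a+b)B$; integrating in [v] first, a shift by [s] gives $\Gamma(a)\Gamma(b)$. The
    computation runs in the extended reals, so finiteness of [B] comes out of it. *)
Lemma beta_integral (a b : R) : 0 < a -> 0 < b ->
  (\int[mu]_s (pker a (1 - s) * pker b s)%:E =
   (Gamma a * Gamma b / Gamma (a + b))%:E)%E.
Proof.
move=> a0 b0; have ab0 := addr_gt0 a0 b0.
set B := (LHS).
have mexp : measurable_fun setT (fun s : R => expR (- s)).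
  by apply: measurableT_comp => //; exact: measurable_expR.
pose F (v s : R) := (pker a (v - s) * pker b s * expR (- v))%:E.
have mF : measurable_fun setT (fun p : R * R => F p.1 p.2).
  apply/measurable_EFinP; apply: measurable_funM.
    apply: measurable_funM; first by apply: measurable_diff2; exact: measurable_pker.
    by apply: (measurableT_comp (measurable_pker b)); exact: measurable_snd.
  by apply: (measurableT_comp mexp); exact: measurable_fst.
have F0 v s : (0 <= F v s)%E.
  by rewrite lee_fin !mulr_ge0 ?pker_ge0 ?expR_ge0.
have := tonelli F mF F0.
have -> : (\int[mu]_v \int[mu]_s F v s = (Gamma (a + b))%:E * B)%E.
  rewrite GammaE// -ge0_integralZr//; last 3 first.
  - exact: measurable_gker.
  - by move=> s _; exact: gker_ge0.
  - by apply: integral_ge0 => s _; rewrite lee_fin mulr_ge0 ?pker_ge0.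
  apply: eq_integral => v _; rewrite /F.
  have [v0|v0] := leP v 0.
    rewrite pker_le0// mul0r mul0e integral0_eq// => s _; congr EFin.
    have [s0|s0] := leP s 0; first by rewrite (pker_le0 b)// mulr0 mul0r.
    by rewrite pker_le0 ?mul0r// subr_le0 (le_trans v0 (ltW s0)).
  under eq_integral do rewrite EFinM.
  rewrite ge0_integralZr//; last 2 first.
  - apply/measurable_EFinP; apply: measurable_funM; last exact: measurable_pker.
    by apply: measurableT_comp; [exact: measurable_pker|exact: measurable_funB].
  - by move=> s _; rewrite lee_fin mulr_ge0 ?pker_ge0.
  by rewrite pker_conv_scale// muleAC -EFinM pkerE.
have -> : (\int[mu]_s \int[mu]_v F v s = (Gamma a)%:E * (Gamma b)%:E)%E.
  rewrite [X in (_ * X)%E]GammaE// -ge0_integralZl//; last 3 first.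
  - exact: measurable_gker.
  - by move=> s _; exact: gker_ge0.
  - by rewrite lee_fin ltW// Gamma_gt0.
  apply: eq_integral => s _.
  rewrite GammaE// [in RHS](integral_shift (- s)); last exact: measurable_gker.
  rewrite -ge0_integralZr//; last 3 first.
  - by apply: (measurableT_comp (measurable_gker a)); exact: measurable_funD.
  - by move=> v _; exact: gker_ge0.
  - exact: gker_ge0.
  apply: eq_integral => v _; rewrite /F -EFinM; congr EFin.
  by rewrite mulrACA -expRD opprB addrAC subrr sub0r.
move=> /(congr1 (fun x => ((Gamma (a + b))^-1%:E * x)%E)).
have Gab : Gamma (a + b) != 0 by rewrite gt_eqF// Gamma_gt0.
rewrite muleA -EFinM mulVf// mul1e => ->.
by rewrite -!EFinM mulrC.
Qed.

Definition rlker (a s : R) : R := pker a s / Gamma a.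

Lemma rlker_ge0 (a s : R) : 0 < a -> 0 <= rlker a s.
Proof. by move=> a0; rewrite divr_ge0 ?pker_ge0// ltW// Gamma_gt0. Qed.

Lemma measurable_rlker (a : R) : measurable_fun setT (rlker a).
Proof. by apply: measurable_funM => //; exact: measurable_pker. Qed.

Lemma rlker_semigroup (a b t : R) : 0 < a -> 0 < b ->
  (\int[mu]_s (rlker a (t - s) * rlker b s)%:E = (rlker (a + b) t)%:E)%E.
Proof.
move=> a0 b0.
have mab : measurable_fun setT (fun s : R => (pker a (t - s) * pker b s)%:E).
  apply/measurable_EFinP; apply: measurable_funM; last exact: measurable_pker.
  by apply: measurableT_comp; [exact: measurable_pker|exact: measurable_funB].
have [t0|t0] := leP t 0.
  rewrite integral0_eq; first by rewrite /rlker pker_le0// mul0r.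
  move=> s _; congr EFin; rewrite /rlker.
  have [s0|s0] := leP s 0; first by rewrite (pker_le0 b)// !mul0r mulr0.
  by rewrite pker_le0 ?mul0r// subr_le0 (le_trans t0 (ltW s0)).
under eq_integral do rewrite /rlker mulrACA EFinM.
rewrite ge0_integralZr//; last 2 first.
- by move=> s _; rewrite lee_fin mulr_ge0 ?pker_ge0.
- by rewrite lee_fin mulr_ge0// invr_ge0 ltW// Gamma_gt0.
rewrite pker_conv_scale// beta_integral// -!EFinM /rlker pkerE//; congr EFin.
move: (Gamma_gt0 a a0) (Gamma_gt0 b b0) (Gamma_gt0 _ (addr_gt0 a0 b0)).
move: (Gamma a) (Gamma b) (Gamma (a + b)) => A B C A0 B0 C0.
by field; rewrite !gt_eqF.
Qed.

End beta.

(** * Convolution on the line *)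

Section convolution.
Context {R : realType}.
Local Notation mu := (@lebesgue_measure R).

Definition convol (f g : R -> R) (t : R) : R := \int[mu]_s (f (t - s) * g s).

Lemma convolE (f g : R -> R) (t : R) :
  convol f g t = \int[mu]_s (f (t - s) * g s).
Proof. by []. Qed.

Definition convol_ex (f g : R -> R) (t : R) : Prop :=
  mu.-integrable setT (fun s : R => (f (t - s) * g s)%:E).

Lemma measurable_convol_integrand (f g : R -> R) (t : R) :
  measurable_fun setT f -> measurable_fun setT g ->
  measurable_fun setT (fun s : R => f (t - s) * g s).
Proof.
move=> mf mg; apply: measurable_funM => //.
by apply: (measurableT_comp mf); exact: measurable_funB.
Qed.

Lemma convol_EFin (f g : R -> R) (t : R) : convol_ex f g t ->
  (\int[mu]_s (f (t - s) * g s)%:E = (convol f g t)%:E)%E.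
Proof. by move=> fg; rewrite /convol /Rintegral fineK//; exact: integrable_fin_num. Qed.

Lemma measurable_convol (f g : R -> R) :
  measurable_fun setT f -> measurable_fun setT g ->
  measurable_fun setT (convol f g).
Proof.
move=> mf mg.
pose F (p : measurableTypeR R * measurableTypeR R) := (f (p.1 - p.2) * g p.2)%:E.
have mF : measurable_fun setT F.
  apply/measurable_EFinP; apply: measurable_funM; first exact: measurable_diff2.
  by apply: (measurableT_comp mg); exact: measurable_snd.
(* Points of divergence are included: there too the value is [fine] of a difference of two
   nonnegative integrals, each measurable in [t] by Tonelli. *)
have -> : convol f g = fine \o ((fun t => \int[mu]_s F^\+ (t, s)) \-
                              (fun t => \int[mu]_s F^\- (t, s)))%E.
  apply/funext => t; rewrite /convol /Rintegral/= integralE; congr (fine (_ - _)).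
    by apply: eq_integral => s _; rewrite !funeposE.
  by apply: eq_integral => s _; rewrite !funenegE.
apply: measurableT_comp; first exact: fine_measurable.
apply: emeasurable_funB.
  exact: (measurable_fun_fubini_tonelli_F _ (measurable_funepos mF)).
exact: (measurable_fun_fubini_tonelli_F _ (measurable_funeneg mF)).
Qed.

Lemma convol_comm (f g : R -> R) (t : R) :
  measurable_fun setT f -> measurable_fun setT g -> convol f g t = convol g f t.
Proof.
move=> mf mg; rewrite /convol /Rintegral (integral_reflection t).
  by congr fine; apply: eq_integral => s _; rewrite subKr mulrC.
by apply/measurable_EFinP; exact: measurable_convol_integrand.
Qed.

Lemma ae_eq_integrable (u v : R -> \bar R) : measurable_fun setT u ->
  ae_eq mu setT u v -> mu.-integrable setT v ->
  mu.-integrable setT u /\ (\int[mu]_x u x = \int[mu]_x v x)%E.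
Proof.
move=> mu_ uv /integrableP[mv iv]; split; last exact: ae_eq_integral.
apply/integrableP; split => //; apply: le_lt_trans iv.
rewrite le_eqVlt; apply/orP; left; apply/eqP; apply: ge0_ae_eq_integral => //.
- exact: measurableT_comp.
- exact: measurableT_comp.
- by apply: filterS uv => x /= /[apply] ->.
Qed.

Lemma convol_causal (f h : R -> R) (t : R) : (forall s, s <= 0 -> f s = 0) ->
  (forall s, s <= 0 -> h s = 0) -> t <= 0 -> convol f h t = 0.
Proof.
move=> f0 h0 t0; rewrite /convol /Rintegral integral0_eq// => s _.
have [s0|s0] := leP s 0; first by rewrite h0// mulr0.
by rewrite f0 ?mul0r// subr_le0 (le_trans t0 (ltW s0)).
Qed.

Lemma convolDl (k1 k2 h : R -> R) (l t : R) : convol_ex k1 h t -> convol_ex k2 h t ->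
  convol (fun s => k1 s + l * k2 s) h t = convol k1 h t + l * convol k2 h t.
Proof.
move=> h1 h2; rewrite /convol -RintegralZl// -RintegralD//; last first.
  have := integrableZl measurableT l h2.
  by apply: eq_integrable => // s _; rewrite -EFinM.
by apply: eq_Rintegral => s _; rewrite mulrDl mulrA.
Qed.

End convolution.

(** * Associativity of convolution by Fubini *)

Section convolution_assoc.
Context {R : realType}.
Local Notation mu := (@lebesgue_measure R).
Variables (f g h : R -> R) (t : R).
Hypotheses (mf : measurable_fun setT f) (mg : measurable_fun setT g)
  (mh : measurable_fun setT h).
Hypothesis fgh :
  (\int[mu]_r (`|h r|%:E * \int[mu]_s `|f (t - r - s) * g s|%:E) < +oo)%E.

Let G (p : measurableTypeR R * measurableTypeR R) : \bar R :=
  (f (t - p.1) * g (p.1 - p.2) * h p.2)%:E.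

Let mG : measurable_fun setT G.
Proof.
apply/measurable_EFinP; apply: measurable_funM.
  apply: measurable_funM; last exact: measurable_diff2.
  apply: (measurableT_comp mf); apply: measurable_funB => //.
by apply: (measurableT_comp mh); exact: measurable_snd.
Qed.

Let inner_shift (r : R) (u : R -> \bar R) : measurable_fun setT u ->
  (\int[mu]_s u (s - r)%R = \int[mu]_s u s)%E.
Proof. by move=> mu_; rewrite [RHS](integral_shift (- r)). Qed.

(** The hypothesis [fgh] is Tonelli's criterion for [G], written in the variable [s - r]. *)
Let iG : (mu \x mu)%E.-integrable setT G.
Proof.
apply/(integrable21ltyP _ _ mG); move: fgh; congr (_ < _)%E.
apply: eq_integral => r _.
rewrite -(inner_shift r); last first.
  apply/measurable_EFinP; apply: measurableT_comp => //.
  exact: measurable_convol_integrand.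
rewrite -ge0_integralZl//.
- by apply: eq_integral => s _; rewrite -EFinM -normrM mulrC opprB addrA subrK.
- apply/measurable_EFinP; apply: measurableT_comp => //.
  apply: measurable_funM.
    by apply: (measurableT_comp mf); apply: measurable_funB => //; exact: measurable_funB.
  by apply: (measurableT_comp mg); exact: measurable_funB.
Qed.

(** For almost every [s] the section of [G] is integrable, and cancelling [f (t - s)] gives
    existence of the inner convolution. Where that factor is 0, both sides vanish whatever default
    value [convol g h s] has. *)
Let inner1 : ae_eq mu setT (fun s => (f (t - s) * convol g h s)%:E)
  (fun s => (\int[mu]_r G (s, r))%E).
Proof.
have := ae_integrable1 iG; apply: filterS => s /= Gs _.
have [fs|fs] := eqVneq (f (t - s)) 0.
  rewrite fs mul0r integral0_eq// => r _.
  by rewrite /G/= fs !mul0r.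
have gh : convol_ex g h s.
  have := integrableZl measurableT (f (t - s))^-1 Gs.
  apply: eq_integrable => // r _.
  by rewrite /G/= -EFinM -mulrA mulKf.
rewrite EFinM -(convol_EFin _ _ _ gh) -integralZl//.
by apply: eq_integral => r _; rewrite /G -EFinM mulrA.
Qed.

Let inner2 : ae_eq mu setT (fun r => (convol f g (t - r) * h r)%:E)
  (fun r => (\int[mu]_s G (s, r))%E).
Proof.
have := ae_integrable2 iG; apply: filterS => r /= Gr _.
have [hr|hr] := eqVneq (h r) 0.
  rewrite hr mulr0 integral0_eq// => s _.
  by rewrite /G/= hr mulr0.
have shiftE (s : R) : f (t - s) * g (s - r) = f (t - r - (s - r)) * g (s - r).
  by rewrite opprB addrA subrK.
have mfg := measurable_convol_integrand _ _ (t - r) mf mg.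
have fg : convol_ex f g (t - r).
  apply/integrableP; split; first exact/measurable_EFinP.
  rewrite -(inner_shift r); last by apply: measurableT_comp => //; exact/measurable_EFinP.
  have /integrableP[_] := integrableZr measurableT (h r)^-1 Gr.
  congr (_ < _)%E; apply: eq_integral => s _.
  by rewrite /cst /G /= mulfK// shiftE.
rewrite EFinM -(convol_EFin _ _ _ fg) -(inner_shift r); last exact/measurable_EFinP.
rewrite -integralZr//; last first.
  have := integrableZr measurableT (h r)^-1 Gr.
  by apply: eq_integrable => // s _; rewrite /cst /G /= -EFinM mulfK// shiftE.
by apply: eq_integral => s _; rewrite /G -EFinM shiftE.
Qed.

Let iG2 : mu.-integrable setT (fun r => (\int[mu]_s G (s, r))%E).
Proof.
apply/integrableP; split; first exact: (measurable_fubini_G iG).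
apply: le_lt_trans ((integrable21ltyP _ _ mG).1 iG).
apply: ge0_le_integral => //.
- by apply: measurableT_comp => //; exact: (measurable_fubini_G iG).
- apply: (measurable_fun_fubini_tonelli_G (abse \o G)) => //=.
  exact: measurableT_comp.
- move=> r _; apply: le_abse_integral => //.
  exact: measurableT_comp.
Qed.

(** Both sides are iterated integrals of [G], up to null sets in the outer variable. The third
    clause is the source of every almost everywhere existence statement for convolutions with an
    $L^1$ function. *)
Lemma convol_assoc : [/\ convol_ex f (convol g h) t, convol_ex (convol f g) h t,
  {ae mu, forall s, f (t - s) != 0 -> convol_ex g h s} &
  convol f (convol g h) t = convol (convol f g) h t].
Proof.
have m1 : measurable_fun setT (fun s : R => (f (t - s) * convol g h s)%:E).
  apply/measurable_EFinP.
  exact: (measurable_convol_integrand _ _ t mf (measurable_convol _ _ mg mh)).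
have m2 : measurable_fun setT (fun s : R => (convol f g (t - s) * h s)%:E).
  apply/measurable_EFinP.
  exact: (measurable_convol_integrand _ _ t (measurable_convol _ _ mf mg) mh).
have [i1 e1] := ae_eq_integrable _ _ m1 inner1 (integrable_fubini_F iG).
have [i2 e2] := ae_eq_integrable _ _ m2 inner2 iG2.
split => //.
  have := ae_integrable1 iG; apply: filterS => s /= Gs fs.
  have := integrableZl measurableT (f (t - s))^-1 Gs.
  apply: eq_integrable => // r _.
  by rewrite /G/= -EFinM -mulrA mulKf.
rewrite /convol /Rintegral e1 e2; congr fine; exact: (Fubini iG).
Qed.

End convolution_assoc.

(** * The Mittag-Leffler kernels: convergence, recursion, monotonicity *)

Section mittag_leffler_kernel.
Context {R : realType}.

(** On [[M, M + 1]] one has $(s/M)^{a-1}\ge(s/M)^{-1}\ge M/(M+1)$, because $s/M\ge1$ and $a-1>-1$;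
    the factor [M / (M + 1)] thus covers [a < 1] together with [a >= 1]. *)
Lemma Gamma_lower_bound (a M : R) : 0 < a -> 0 < M ->
  M `^ (a - 1) * (M / (M + 1)) * expR (- (M + 1)) <= Gamma a.
Proof.
move=> a0 M0; have M10 : 0 < M + 1 by rewrite addr_gt0.
apply: Gamma_ge => //; first by rewrite mulr_ge0 ?powR_ge0// divr_ge0 ?ltW.
move=> s /andP[Ms sM]; have s0 : 0 < s by exact: lt_le_trans Ms.
have sM1 : 1 <= s / M by rewrite ler_pdivlMr// mul1r.
rewrite -[in leRHS](divfK (lt0r_neq0 M0) s) powRM ?divr_ge0 ?(ltW s0) ?(ltW M0)//.
rewrite mulrC ler_wpM2r ?powR_ge0//.
apply: (@le_trans _ _ ((s / M) `^ (-1))); last first.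
  by apply: ler_powR => //; lra.
rewrite powR_inv1 ?divr_ge0 ?(ltW s0) ?(ltW M0)// invf_div ler_pM2l//.
by rewrite lef_pV2.
Qed.

Variables (gam : R).
Hypothesis gam0 : 0 < gam.

Definition mlterm (c b t : R) (k : nat) : R := c ^+ k * rlker (gam * k%:R + b) t.

Definition mlker (c b t : R) : R := limn (series (mlterm c b t)).

Lemma mlarg_gt0 (b : R) (k : nat) : 0 < b -> 0 < gam * k%:R + b.
Proof. by move=> b0; rewrite ltr_wpDl// mulr_ge0// ltW. Qed.

Lemma mlterm_ge0 (c b t : R) (k : nat) : 0 <= c -> 0 < b -> 0 <= mlterm c b t k.
Proof. by move=> c0 b0; rewrite mulr_ge0 ?exprn_ge0 ?rlker_ge0 ?mlarg_gt0. Qed.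

Lemma norm_mlterm (c b t : R) (k : nat) : 0 < b ->
  `|mlterm c b t k| = mlterm `|c| b t k.
Proof.
by move=> b0; rewrite normrM normrX [X in _ * X]ger0_norm// rlker_ge0// mlarg_gt0.
Qed.

Lemma rlker_le0 (a t : R) : t <= 0 -> rlker a t = 0.
Proof. by move=> t0; rewrite /rlker pker_le0// mul0r. Qed.

Lemma rlkerE (a t : R) : 0 < t -> rlker a t = t `^ (a - 1) / Gamma a.
Proof. by move=> t0; rewrite /rlker pkerE. Qed.

Lemma is_cvg_mlterm_abs (c b t : R) : 0 <= c -> 0 < b ->
  cvgn (series (mlterm c b t)).
Proof.
move=> c0 b0; have [t0|t0] := leP t 0.
  have -> : series (mlterm c b t) = cst 0.
    apply/funext => n; rewrite /series/= big1// => k _.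
    by rewrite /mlterm rlker_le0// mulr0.
  exact: is_cvg_cst.
(* [q] makes the comparison series geometric with ratio [c q^gam <= 1/2] *)
pose q : R := (2 * (c + 1))^-1 `^ gam^-1.
have c10 : 0 < 2 * (c + 1) by rewrite mulr_gt0// ltr_wpDl.
have q0 : 0 < q by rewrite powR_gt0// invr_gt0.
have qg : q `^ gam = (2 * (c + 1))^-1.
  rewrite /q -powRrM mulVf ?gt_eqF// powRr1// invr_ge0; exact: ltW.
(* For this [M] the lower bound on Gamma turns $t^{\alpha-1}/\Gamma(\alpha)$ into at most a constant
   times $q^{\alpha-1}$, which is geometric in [k] for $\alpha=\gamma k+b$; [K] collects the factors
   independent of [k]. *)
pose M := t / q.
have M0 : 0 < M by rewrite divr_gt0.
pose K := q `^ (b - 1) * (M / (M + 1))^-1 * expR (M + 1).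
have K0 : 0 < K.
  by rewrite /K !mulr_gt0 ?powR_gt0 ?expR_gt0 ?invr_gt0 ?divr_gt0 ?addr_gt0.
have z1 : `|c * q `^ gam| < 1.
  rewrite ger0_norm ?mulr_ge0 ?powR_ge0// qg ltr_pdivrMr//; lra.
apply: (@series_le_cvg _ _ (geometric K (c * q `^ gam))).
- by move=> k; exact: mlterm_ge0.
- by move=> k; rewrite geometric_ge0 ?(ltW K0)// mulr_ge0 ?powR_ge0.
- move=> k; rewrite /geometric/= /mlterm rlkerE//.
  have a0 := mlarg_gt0 b k b0.
  rewrite exprMn -(powR_mulrn _ (powR_ge0 _ _)) -powRrM.
  rewrite [leRHS]mulrCA ler_wpM2l ?exprn_ge0//.
  rewrite ler_pdivrMr ?Gamma_gt0//.
  have := Gamma_lower_bound _ _ a0 M0.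
  rewrite -(ler_pM2l (_ : 0 < K * q `^ (gam * k%:R))); last first.
    exact: mulr_gt0 K0 (powR_gt0 _ q0).
  apply: le_trans.
  rewrite -[in leLHS](divfK (lt0r_neq0 q0) t) -/M powRM ?(ltW M0) ?(ltW q0)//.
  have -> : q `^ (gam * k%:R + b - 1) = q `^ (gam * k%:R) * q `^ (b - 1).
    by rewrite -powRD ?addrA// (gt_eqF q0) implybT.
  rewrite expRN /K le_eqVlt; apply/orP; left; apply/eqP.
  move: (q `^ _) (q `^ _) (M `^ _) (expR_gt0 (M + 1)) => x y z.
  move: (expR _) => e e0.
  by field; rewrite !gt_eqF// addr_gt0.
- exact: is_cvg_geometric_series.
Qed.

Lemma is_cvg_mlterm (c b t : R) : 0 < b -> cvgn (series (mlterm c b t)).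
Proof.
move=> b0; apply: normed_cvg.
rewrite (_ : [normed series (mlterm c b t)] = series (mlterm `|c| b t)).
  exact: is_cvg_mlterm_abs.
by congr series; apply/funext => k; exact: norm_mlterm.
Qed.

Lemma mlkerE (b c t : R) : 0 < b -> 0 < t ->
  mlker c b t = t `^ (b - 1) * mittag_leffler gam b (c * t `^ gam).
Proof.
move=> b0 t0; pose u k := (c * t `^ gam) ^+ k / Gamma (gam * k%:R + b).
have termE k : mlterm c b t k = t `^ (b - 1) * u k.
  rewrite /mlterm rlkerE// /u exprMn -(powR_mulrn _ (powR_ge0 _ _)) -powRrM.
  rewrite -addrA (addrC (gam * _)) [t `^ (_ + gam * _)]powRD; last first.
    by rewrite (gt_eqF t0) implybT.
  by rewrite -!mulrA mulrCA.
have tb : t `^ (b - 1) != 0 by rewrite gt_eqF// powR_gt0.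
have seriesE' : series (mlterm c b t) = (t `^ (b - 1)) *: series u.
  by rewrite -seriesZ; congr series; apply/funext => k; exact: termE.
have cu : cvgn (series u).
  have -> : series u = (t `^ (b - 1))^-1 *: series (mlterm c b t).
    by rewrite seriesE' scalerA mulVf// scale1r.
  by apply: is_cvgZl_tmp; exact: is_cvg_mlterm.
by rewrite /mlker seriesE' /mittag_leffler limZl_tmp.
Qed.

Lemma mlkerS (c b t : R) : 0 < b ->
  mlker c b t = rlker b t + c * mlker c (gam + b) t.
Proof.
move=> b0; have gb0 := addr_gt0 gam0 b0.
have shift n : series (mlterm c b t) n.+1 =
    rlker b t + c * series (mlterm c (gam + b) t) n.
  rewrite /series/= big_nat_recl//; congr (_ + _).
    by rewrite /mlterm expr0 mul1r mulr0 add0r.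
  rewrite mulr_sumr; apply: eq_bigr => k _.
  by rewrite /mlterm exprS mulrA; congr (_ * rlker _ _); rewrite -natr1; ring.
apply/cvg_lim => //; rewrite -cvg_shiftS.
rewrite (eq_cvg _ _ shift); apply: cvgD; first exact: cvg_cst.
by apply: cvgMl_tmp; exact: is_cvg_mlterm.
Qed.

Lemma measurable_mlterm_series (c b : R) (n : nat) :
  measurable_fun setT (fun t : R => series (mlterm c b t) n).
Proof.
apply: measurable_sum => k; apply: measurable_funM => //.
exact: measurable_rlker.
Qed.

Lemma measurable_mlker (c b : R) : 0 < b -> measurable_fun setT (mlker c b).
Proof.
move=> b0; apply: (measurable_fun_cvg (fun n => measurable_mlterm_series c b n)).
by move=> t _; exact: is_cvg_mlterm.
Qed.

Lemma mlker_le0 (c b t : R) : t <= 0 -> mlker c b t = 0.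
Proof.
move=> t0; apply/cvg_lim => //.
have -> : series (mlterm c b t) = cst 0.
  apply/funext => n; rewrite /series/= big1// => k _.
  by rewrite /mlterm rlker_le0// mulr0.
exact: cvg_cst.
Qed.

Lemma mlseries_norm_le (c b t : R) (n : nat) : 0 < b ->
  `|series (mlterm c b t) n| <= mlker `|c| b t.
Proof.
move=> b0; apply: (@le_trans _ _ (series (mlterm `|c| b t) n)).
  rewrite /series/= (le_trans (ler_norm_sum _ _ _))// le_eqVlt.
  by apply/orP; left; apply/eqP; apply: eq_bigr => k _; exact: norm_mlterm.
apply: nondecreasing_cvgn_le; last exact: is_cvg_mlterm.
by apply: nondecreasing_series => k _ _; exact: mlterm_ge0.
Qed.

Lemma mlker_norm_le (c b t : R) : 0 < b -> `|mlker c b t| <= mlker `|c| b t.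
Proof.
move=> b0; have h := is_cvg_mlterm c b t b0.
have hn : `|series (mlterm c b t) n| @[n --> \oo] --> `|mlker c b t|.
  exact: cvg_norm.
rewrite -(cvg_lim _ hn)//; apply: limr_le; first by apply/cvg_ex; eexists; exact: hn.
by apply: nearW => n; exact: mlseries_norm_le.
Qed.

Lemma mlker_ge0 (c b t : R) : 0 <= c -> 0 < b -> 0 <= mlker c b t.
Proof.
move=> c0 b0; apply: le_trans (normr_ge0 (mlker c b t)) _.
by rewrite -{2}(ger0_norm c0) mlker_norm_le.
Qed.

Lemma rlker_mono (a s t : R) : 1 <= a -> s <= t -> rlker a s <= rlker a t.
Proof.
move=> a1 st; have a0 : 0 < a by exact: lt_le_trans a1.
have [s0|s0] := leP s 0; first by rewrite rlker_le0// rlker_ge0.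
rewrite !rlkerE ?(lt_le_trans s0)// ler_pM2r ?invr_gt0 ?Gamma_gt0//.
by apply: ge0_ler_powR => //; rewrite ?subr_ge0 ?nnegrE ?(ltW s0) ?(le_trans (ltW s0)).
Qed.

(** All orders [gam * k + b] are at least 1, so every term of the series is nondecreasing. *)
Lemma mlker_mono (c b s t : R) : 0 <= c -> 1 <= b -> s <= t ->
  mlker c b s <= mlker c b t.
Proof.
move=> c0 b1 st; have b0 : 0 < b by exact: lt_le_trans b1.
apply: lim_series_le; [exact: is_cvg_mlterm|exact: is_cvg_mlterm|].
move=> k; rewrite ler_wpM2l ?exprn_ge0// rlker_mono//.
by rewrite ler_wpDl// mulr_ge0// ltW.
Qed.

End mittag_leffler_kernel.

(** * Fractional integrals of the Mittag-Leffler kernels *)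

Section mittag_leffler_convolution.
Context {R : realType}.
Local Notation mu := (@lebesgue_measure R).
Variables (gam : R).
Hypothesis gam0 : 0 < gam.

Lemma convol_ex_ge0 (f g : R -> R) (t l : R) :
  measurable_fun setT f -> measurable_fun setT g ->
  (forall s, 0 <= f s) -> (forall s, 0 <= g s) ->
  (\int[mu]_s (f (t - s) * g s)%:E = l%:E)%E -> convol_ex f g t /\ convol f g t = l.
Proof.
move=> mf mg f0 g0 fg; split; last by rewrite /convol /Rintegral fg.
apply/integrableP; split.
  by apply/measurable_EFinP; exact: measurable_convol_integrand.
under eq_integral do rewrite gee0_abs ?lee_fin ?mulr_ge0//.
by rewrite fg ltry.
Qed.

Lemma convol_rlker (a b t : R) : 0 < a -> 0 < b ->
  convol_ex (rlker a) (rlker b) t /\ convol (rlker a) (rlker b) t = rlker (a + b) t.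
Proof.
move=> a0 b0; apply: convol_ex_ge0.
- exact: measurable_rlker.
- exact: measurable_rlker.
- by move=> s; exact: rlker_ge0.
- by move=> s; exact: rlker_ge0.
- exact: rlker_semigroup.
Qed.

Lemma nneseries_mlterm (c b t : R) : 0 <= c -> 0 < b ->
  (\sum_(0 <= k <oo) (mlterm gam c b t k)%:E = (mlker gam c b t)%:E)%E.
Proof.
move=> c0 b0; rewrite -EFin_lim; last exact: is_cvg_mlterm.
by congr (limn _); apply/funext => n; rewrite /= sumEFin.
Qed.

Lemma integral_rlker_mlker (c a b t : R) : 0 <= c -> 0 < a -> 0 < b ->
  (\int[mu]_s (rlker a (t - s) * mlker gam c b s)%:E =
   (mlker gam c (a + b) t)%:E)%E.
Proof.
move=> c0 a0 b0.
have term_ge0 k s : 0 <= rlker a (t - s) * mlterm gam c b s k.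
  by rewrite mulr_ge0 ?rlker_ge0 ?mlterm_ge0.
transitivity (\int[mu]_s \sum_(0 <= k <oo)
    (rlker a (t - s) * mlterm gam c b s k)%:E)%E.
  apply: eq_integral => s _; rewrite EFinM -nneseries_mlterm// -nneseriesZl//.
  - by move=> k _; rewrite lee_fin mlterm_ge0.
rewrite integral_nneseries//; last 2 first.
- move=> k; apply/measurable_EFinP; apply: measurable_convol_integrand.
    exact: measurable_rlker.
  by apply: measurable_funM => //; exact: measurable_rlker.
- by move=> k s _; rewrite lee_fin.
rewrite -nneseries_mlterm ?addr_gt0//; apply: eq_eseriesr => k _.
under eq_integral do rewrite /mlterm mulrCA EFinM.
have gkb := mlarg_gt0 _ gam0 b k b0.
rewrite ge0_integralZl//.
- by rewrite (rlker_semigroup _ _ _ a0 gkb) -EFinM (addrCA a).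
- apply/measurable_EFinP; apply: measurable_convol_integrand; exact: measurable_rlker.
- by move=> s _; rewrite lee_fin mulr_ge0 ?rlker_ge0.
- by rewrite lee_fin exprn_ge0.
Qed.

(** For signed [c] the partial sums are dominated by the kernel with $|c|$, whose convolution is
    finite by [integral_rlker_mlker]; dominated convergence then allows integration term by term. *)
Lemma convol_rlker_mlker (c a b t : R) : 0 < a -> 0 < b ->
  convol_ex (rlker a) (mlker gam c b) t /\
  convol (rlker a) (mlker gam c b) t = mlker gam c (a + b) t.
Proof.
move=> a0 b0; have ab0 := addr_gt0 a0 b0.
have mS n : measurable_fun setT (fun s : R => rlker a (t - s) * series (mlterm gam c b s) n).
  apply: measurable_convol_integrand; first exact: measurable_rlker.
  exact: measurable_mlterm_series.
have mL : measurable_fun setT (fun s : R => rlker a (t - s) * mlker gam c b s).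
  apply: measurable_convol_integrand; first exact: measurable_rlker.
  exact: measurable_mlker.
have term_int k : mu.-integrable setT
    (fun s : R => (rlker a (t - s) * mlterm gam c b s k)%:E).
  have [h _] := convol_rlker a _ t a0 (mlarg_gt0 _ gam0 b k b0).
  have := integrableZl measurableT (c ^+ k) h.
  by apply: eq_integrable => // s _; rewrite -EFinM mulrCA.
have dom : mu.-integrable setT (fun s : R => (rlker a (t - s) * mlker gam `|c| b s)%:E).
  apply: (convol_ex_ge0 _ _ _ (mlker gam `|c| (a + b) t) _ _ _ _ _).1.
  - exact: measurable_rlker.
  - exact: measurable_mlker.
  - by move=> s; exact: rlker_ge0.
  - by move=> s; exact: mlker_ge0.
  - exact: integral_rlker_mlker.
have [] := @dominated_convergence _ _ _ mu setT measurableT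
  (fun n s => (rlker a (t - s) * series (mlterm gam c b s) n)%:E)
  (fun s => (rlker a (t - s) * mlker gam c b s)%:E)
  (fun s => (rlker a (t - s) * mlker gam `|c| b s)%:E).
- by move=> n; apply/measurable_EFinP; exact: mS.
- by apply/measurable_EFinP; exact: mL.
- apply: aeW => s _; apply: cvg_EFin; first by apply: nearW.
  by apply: cvgMl_tmp; exact: is_cvg_mlterm.
- exact: dom.
- apply: aeW => s n _; rewrite /= lee_fin normrM ger0_norm ?rlker_ge0//.
  by rewrite ler_wpM2l ?rlker_ge0// mlseries_norm_le.
move=> ex _ lim; split => //.
rewrite /convol /Rintegral -(cvg_lim _ lim)//.
have -> : (fun n => \int[mu]_s (rlker a (t - s) * series (mlterm gam c b s) n)%:E)%E =
    EFin \o series (mlterm gam c (a + b) t).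
  apply/funext => n; rewrite /series/= -sumEFin.
  under eq_integral do rewrite mulr_sumr -sumEFin.
  rewrite integral_sum//; apply: eq_bigr => k _.
  have gkb := mlarg_gt0 _ gam0 b k b0.
  under eq_integral do rewrite /mlterm mulrCA EFinM.
  rewrite integralZl//; last exact: (convol_rlker _ _ _ a0 gkb).1.
  by rewrite (rlker_semigroup _ _ _ a0 gkb) -EFinM (addrCA a).
by rewrite EFin_lim//; exact: is_cvg_mlterm.
Qed.

End mittag_leffler_convolution.

(** * Fractional integrals as convolutions, and convolution with an integrable function *)

Section fractional_integral.
Context {R : realType}.
Local Notation mu := (@lebesgue_measure R).

(** The counterpart of [frac_int] on the line; [frac_intE] relates the two. Order 0 is a case of its
    own because $g_0$ is not a function. *)
Definition rint (a : R) (f : R -> R) : R -> R :=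
  if a == 0 then f else convol (rlker a) f.

Definition rint_ex (a : R) (f : R -> R) (t : R) : Prop :=
  a != 0 -> convol_ex (rlker a) f t.

Lemma measurable_rint (a : R) (f : R -> R) :
  measurable_fun setT f -> measurable_fun setT (rint a f).
Proof.
rewrite /rint; case: ifPn => // _ mf; apply: measurable_convol => //.
exact: measurable_rlker.
Qed.

Lemma convol_exD (k f g : R -> R) (t : R) : convol_ex k f t -> convol_ex k g t ->
  convol_ex k (f \+ g) t /\ convol k (f \+ g) t = convol k f t + convol k g t.
Proof.
move=> kf kg; split.
  have := integrableD measurableT kf kg.
  by apply: eq_integrable => // s _; rewrite /= mulrDr.
rewrite /convol -RintegralD//.
by apply: eq_Rintegral => s _; rewrite /= mulrDr.
Qed.

Lemma convol_exZ (k f : R -> R) (l t : R) : convol_ex k f t ->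
  convol_ex k (fun s => l * f s) t /\ convol k (fun s => l * f s) t = l * convol k f t.
Proof.
move=> kf; split.
  have := integrableZl measurableT l kf.
  by apply: eq_integrable => // s _; rewrite /= -EFinM mulrCA.
rewrite /convol -RintegralZl//.
by apply: eq_Rintegral => s _; rewrite mulrCA.
Qed.

Lemma rintD (a : R) (f g : R -> R) (t : R) : rint_ex a f t -> rint_ex a g t ->
  rint_ex a (f \+ g) t /\ rint a (f \+ g) t = rint a f t + rint a g t.
Proof.
rewrite /rint_ex /rint; case: eqVneq => //= _ /(_ isT) kf /(_ isT) kg.
by have [] := convol_exD _ _ _ _ kf kg.
Qed.

Lemma rintZ (a : R) (f : R -> R) (l t : R) : rint_ex a f t ->
  rint_ex a (fun s => l * f s) t /\ rint a (fun s => l * f s) t = l * rint a f t.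
Proof.
rewrite /rint_ex /rint; case: eqVneq => //= _ /(_ isT) kf.
by have [] := convol_exZ _ _ l _ kf.
Qed.

(** The kernel cuts off [s >= t] and [f0] cuts off [s <= 0], so the integrand on the line lives on
    []0, t[]. Agreement at the end [s = t] serves order 0, which is evaluation at [t]. *)
Lemma frac_intE (a : R) (f f0 : R -> R) (t : R) : 0 <= a -> 0 < t ->
  (forall s, 0 < s <= t -> f0 s = f s) -> (forall s, s <= 0 -> f0 s = 0) ->
  rint_ex a f0 t -> frac_int_ex a f t /\ frac_int a f t = rint a f0 t.
Proof.
move=> a0 t0 f0f f00; rewrite /rint_ex /frac_int_ex /frac_int /rint.
case: eqVneq => [_ _|an0 /(_ isT) ex] /=.
  by rewrite f0f ?t0 ?lexx.
have {}a0 : 0 < a by rewrite lt0r an0.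
have Ga := Gamma_gt0 a a0.
have E : (fun s => (t - s) `^ (a - 1) * f s) \_ `]0, t[ =
    (fun s => Gamma a * (rlker a (t - s) * f0 s)).
  apply/funext => s; rewrite patchE; case: ifPn => [|].
    rewrite inE/= in_itv/= => /andP[s0 st].
    rewrite rlkerE ?subr_gt0// f0f ?s0 ?ltW//.
    by rewrite mulrA mulrCA divff ?mulr1// gt_eqF.
  rewrite notin_setE/= in_itv/= => /negP; rewrite negb_and -!leNgt => /orP[s0|ts].
    by rewrite f00// !mulr0.
  by rewrite rlker_le0 ?mul0r ?mulr0// subr_le0.
split=> [_|].
  apply/(integrable_mkcond _ _).2 => //.
  have := integrableZl measurableT (Gamma a) ex.
  apply: eq_integrable => // s _.
  by rewrite -EFinM -[RHS]/((EFin \o _) \_ _ s) restrict_EFin /= E.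
rewrite Rintegral_mkcond E RintegralZl//.
by rewrite mulrA mulVf ?mul1r// gt_eqF.
Qed.

Variables (gam : R).
Hypothesis gam0 : 0 < gam.

(** Through the value [c = 0] the results on [mlker] also apply to the Riemann-Liouville kernels. *)
Lemma mlker0 (b : R) : 0 < b -> mlker gam 0 b = rlker b.
Proof. by move=> b0; apply/funext => t; rewrite mlkerS// mul0r addr0. Qed.

Lemma rint_mlker (a c b t : R) : 0 <= a -> 0 < b ->
  rint_ex a (mlker gam c b) t /\ rint a (mlker gam c b) t = mlker gam c (a + b) t.
Proof.
rewrite /rint_ex /rint le0r; case: eqVneq => [-> _ _|_ /= a0 b0].
  by rewrite add0r.
by have [] := convol_rlker_mlker gam gam0 c a b t a0 b0.
Qed.

Variables (c : R) (phi : R -> R).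
Hypothesis mphi : measurable_fun setT phi.
Hypothesis iphi : mu.-integrable setT (EFin \o phi).
Hypothesis phi0 : forall s, s <= 0 -> phi s = 0.

(** Only [r > 0] contributes, since [phi] vanishes elsewhere; then [t - r < t], and monotonicity of
    [B] bounds the inner integral by the constant [B t]. What remains is the $L^1$ norm of [phi]. *)
Let triple_finite (f g : R -> R) (B : R -> R) (t : R) :
  measurable_fun setT f -> measurable_fun setT g ->
  (forall s s', s <= s' -> B s <= B s') ->
  (forall r, \int[mu]_s `|f (r - s) * g s|%:E <= (B r)%:E)%E ->
  (\int[mu]_r (`|phi r|%:E * \int[mu]_s `|f (t - r - s) * g s|%:E) < +oo)%E.
Proof.
move=> mf mg Bmono fgB.
have B0 : 0 <= B t.
  by rewrite -lee_fin (le_trans _ (fgB t))//; exact: integral_ge0.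
have mabs : measurable_fun setT (fun r => `|phi r|%:E).
  by apply/measurable_EFinP; exact: measurableT_comp.
apply: (@le_lt_trans _ _ (\int[mu]_r ((B t)%:E * `|phi r|%:E))%E); last first.
  rewrite ge0_integralZl//.
  by move/integrableP : iphi => [_ fin]; rewrite lte_mul_pinfty.
apply: ge0_le_integral => //.
- by move=> r _; rewrite mule_ge0//; exact: integral_ge0.
- apply: emeasurable_funM => //.
  pose G (p : measurableTypeR R * measurableTypeR R) : \bar R :=
    `|f (t - p.1 - p.2) * g p.2|%:E.
  apply: (measurable_fun_fubini_tonelli_F G); last by move=> p; rewrite lee_fin.
  apply/measurable_EFinP; apply: measurableT_comp => //.
  apply: measurable_funM.
    apply: (measurableT_comp mf); apply: measurable_funB => //.
    exact: measurable_funB.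
  by apply: (measurableT_comp mg); exact: measurable_snd.
- by apply: measurable_funeM.
- move=> r _; have [r0|r0] := leP r 0; first by rewrite phi0// normr0 mul0e mule0.
  rewrite muleC lee_wpmul2r//; apply: (le_trans (fgB _)).
  by rewrite lee_fin Bmono// gerBl ltW.
Qed.

Lemma integral_norm_rlker_mlker (a b t : R) : 0 < a -> 0 < b ->
  (\int[mu]_s `|rlker a (t - s) * mlker gam c b s|%:E <=
   (mlker gam `|c| (a + b) t)%:E)%E.
Proof.
move=> a0 b0; rewrite -integral_rlker_mlker//; apply: ge0_le_integral => //.
- apply/measurable_EFinP; apply: measurableT_comp => //.
  apply: measurable_convol_integrand; [exact: measurable_rlker|exact: measurable_mlker].
- apply/measurable_EFinP.
  apply: measurable_convol_integrand; [exact: measurable_rlker|exact: measurable_mlker].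
- move=> s _; rewrite lee_fin normrM ger0_norm ?rlker_ge0//.
  by rewrite ler_wpM2l ?rlker_ge0// mlker_norm_le.
Qed.

(** Each order may be below 1, with a kernel unbounded at 0; it is the sum that has to reach 1, so
    that [mlker gam |c| (a + b)] is a monotone bound for [triple_finite]. The inner convolution, of
    order [b], is obtained only almost everywhere. *)
Lemma convol_rlker_convol (a b t : R) : 0 < a -> 0 < b -> 1 <= a + b ->
  [/\ convol_ex (rlker a) (convol (mlker gam c b) phi) t,
      convol_ex (mlker gam c (a + b)) phi t,
      {ae mu, forall s, s < t -> convol_ex (mlker gam c b) phi s} &
      convol (rlker a) (convol (mlker gam c b) phi) t =
      convol (mlker gam c (a + b)) phi t].
Proof.
move=> a0 b0 ab1.
have mr := @measurable_rlker R a.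
have mm := measurable_mlker gam gam0 c b b0.
have E : mlker gam c (a + b) = convol (rlker a) (mlker gam c b).
  apply/funext => s; symmetry.
  exact: (convol_rlker_mlker gam gam0 c a b s a0 b0).2.
have H : (\int[mu]_r (`|phi r|%:E *
    \int[mu]_s `|rlker a (t - r - s) * mlker gam c b s|%:E) < +oo)%E.
  apply: (triple_finite _ _ (mlker gam `|c| (a + b))) => //.
    by move=> s s' ss'; exact: mlker_mono.
  by move=> r; exact: integral_norm_rlker_mlker.
have [h1 h2 h3 h4] := convol_assoc _ _ _ t mr mm mphi H.
rewrite E; split => //.
move: h3; apply: filterS; first exact: (ae_filter_ringOfSetsType mu).
move=> s /= h st; apply: h.
by rewrite rlkerE ?subr_gt0// gt_eqF// divr_gt0 ?Gamma_gt0// powR_gt0// subr_gt0.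
Qed.

Lemma convol_mlker_rlker (a b t : R) : 0 < a -> 0 < b -> 1 <= a + b ->
  convol_ex (mlker gam c b) (convol (rlker a) phi) t /\
  convol (mlker gam c b) (convol (rlker a) phi) t = convol (mlker gam c (a + b)) phi t.
Proof.
move=> a0 b0 ab1.
have mr := @measurable_rlker R a.
have mm := measurable_mlker gam gam0 c b b0.
have E : mlker gam c (a + b) = convol (mlker gam c b) (rlker a).
  apply/funext => s; rewrite (convol_comm _ _ s mm mr); symmetry.
  exact: (convol_rlker_mlker gam gam0 c a b s a0 b0).2.
suff H : (\int[mu]_r (`|phi r|%:E *
    \int[mu]_s `|mlker gam c b (t - r - s) * rlker a s|%:E) < +oo)%E.
  by have [h1 _ _ h2] := convol_assoc _ _ _ t mm mr mphi H; rewrite E.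
apply: (triple_finite _ _ (mlker gam `|c| (a + b))) => //.
  by move=> s s' ss'; exact: mlker_mono.
(* Reflecting [s] to [r - s] exchanges the two kernels and leads back to the bound already known. *)
move=> r; rewrite (integral_reflection r); last first.
  apply/measurable_EFinP; apply: measurableT_comp => //.
  exact: measurable_convol_integrand.
under eq_integral do rewrite subKr mulrC.
exact: integral_norm_rlker_mlker.
Qed.

End fractional_integral.

(** * Measurability of the total derivative of a continuous function *)

Section derivative_measurable.
Context {R : realType}.
Variable f : R -> R.
Hypothesis cf : continuous f.

Let quot (h t : R) : R := h^-1 * (f (h + t) - f t).

Let continuous_quot (h : R) : continuous (quot h).
Proof.
move=> t; apply: cvgMl_tmp; apply: cvgB; last exact: cf.
apply: (@continuous_comp _ _ _ (fun t => h + t) f); last exact: cf.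
by apply: cvgD; [exact: cvg_cst|exact: cvg_id].
Qed.

Let small (m : nat) : set (R * R) :=
  [set p | (p.1 != 0 /\ `|p.1| < m.+1%:R^-1) /\ (p.2 != 0 /\ `|p.2| < m.+1%:R^-1)].

Let osc (n m : nat) : set R :=
  \bigcap_(p in small m) (fun t => `|quot p.1 t - quot p.2 t|) @^-1` [set x | x <= n.+1%:R^-1].

Let closed_osc (n m : nat) : closed (osc n m).
Proof.
apply: closed_bigI => p _; apply: preimage_closed; last exact: closed_le.
move=> t _; apply: (@continuous_comp _ _ _ (fun t => quot p.1 t - quot p.2 t) Num.norm).
  by apply: cvgB; exact: continuous_quot.
exact: norm_continuous.
Qed.

Let quotE t : (fun h : R => h^-1 *: ((f \o shift t) (h *: 1) - f t)) = quot ^~ t.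
Proof. by apply/funext => h; rewrite /quot /= /GRing.scale /= mulr1. Qed.

(* Cauchy's criterion; [osc n m] is closed because difference quotients with a
   fixed step are continuous. *)
Let derivableE : [set t | derivable f t 1] = \bigcap_n \bigcup_m osc n m.
Proof.
apply/seteqP; split=> t /=; rewrite /derivable quotE.
  move=> /cvg_ex[l /cvgrPdist_lt ql] n _.
  have e0 : (0 : R) < n.+1%:R^-1 / 2 by rewrite divr_gt0// invr_gt0.
  have /nbhs_ballP[d /= d0 dq] := ql _ e0.
  have [m _ md] := near_infty_natSinv_lt (PosNum d0).
  exists m => // -[h k] /= [[h0 hm] [k0 km]] /=.
  have near_l (x : R) : x != 0 -> `|x| < m.+1%:R^-1 -> `|l - quot x t| < n.+1%:R^-1 / 2.
    move=> x0 xm; apply: dq => //; rewrite /ball/= sub0r normrN.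
    by apply: lt_trans xm _; apply: md => /=.
  have := ler_distD l (quot h t) (quot k t).
  move=> /le_trans; apply; rewrite (splitr n.+1%:R^-1) lerD// ltW//.
    by rewrite distrC near_l.
  by rewrite near_l.
move=> H; apply/cauchy_cvgP/cauchy_exP => e e0.
have [n _ ne] := near_infty_natSinv_lt (PosNum e0).
have [m _ Hm] := H n I.
have m0 : (0 : R) < m.+1%:R^-1 by rewrite invr_gt0.
(* Any admissible step serves as reference: all other quotients with small steps lie within
   [1 / (n + 1)] of this one. *)
pose h0 : R := m.+1%:R^-1 / 2.
have h00 : 0 < h0 by rewrite divr_gt0.
exists (quot h0 t); rewrite /= nbhs_simpl /=.
apply/nbhs_ballP; exists m.+1%:R^-1 => //= h; rewrite /ball/= sub0r normrN => hm hn0.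
apply: le_lt_trans (ne n (leqnn n)).
apply: (Hm (h0, h)); split; split => //=; first by rewrite gt_eqF.
by rewrite gtr0_norm// /h0 ltr_pdivrMr// mulr_natr mulr2n ltrDl.
Qed.

Let measurable_derivable : measurable [set t | derivable f t 1].
Proof.
rewrite derivableE; apply: bigcapT_measurable => n.
apply: bigcupT_measurable => m; apply: closed_measurable; exact: closed_osc.
Qed.

(** At points of differentiability the derivative is the limit of the quotients with steps
    [1 / (n + 1)]; elsewhere [lim] has the default value 0. Hence it is everywhere the limit of
    these quotients restricted to the measurable set of differentiability. *)
Lemma measurable_derive1 : measurable_fun setT (f^`())%classic.
Proof.
pose q (n : nat) : R -> R := quot n.+1%:R^-1 \_ [set t | derivable f t 1].
apply: (@measurable_fun_cvg _ _ _ setT q) => [n|t _].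
  apply/measurable_restrict => //.
  apply: measurable_funTS; apply: continuous_measurable_fun.
  exact: continuous_quot.
have derive1E' : (f^`())%classic t = lim (quot ^~ t h @[h --> 0^']) by [].
have derivableE' : derivable f t 1 <-> cvg (quot ^~ t h @[h --> 0^']).
  by rewrite /derivable -quotE.
have seq0 : (n.+1%:R^-1 : R) @[n --> \oo] --> (0 : R)^'.
  move=> A HA.
  have /nbhs_ballP[d /= d0 dA] : nbhs (0 : R) (fun x => x != 0 -> A x) := HA.
  have [n _ nd] := near_infty_natSinv_lt (PosNum d0).
  exists n => // k /= nk; apply: dA; last by rewrite invr_neq0.
  by rewrite /ball/= sub0r normrN ger0_norm ?invr_ge0//; exact: nd.
have [ft|ft] := pselect (derivable f t 1).
  rewrite (_ : q ^~ t = fun n => quot n.+1%:R^-1 t); last first.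
    by apply/funext => n; rewrite /q patchE mem_set.
  rewrite derive1E'; exact: (cvg_comp _ _ seq0 (derivableE'.1 ft)).
rewrite (_ : q ^~ t = fun n => 0); last first.
  by apply/funext => n; rewrite /q patchE memNset.
rewrite derive1E' dvgP; first exact: cvg_cst.
by move=> h; apply: ft; apply/derivableE'.
Qed.

End derivative_measurable.

(** * Convolution with $g_1$ as a primitive *)

Section primitive.
Context {R : realType}.
Local Notation mu := (@lebesgue_measure R).

Lemma Gamma1 : Gamma (1 : R) = 1.
Proof.
apply: EFin_inj; rewrite GammaE// -(integral_exponential_pdf (@ltr01 R)).
apply: ae_eq_integral => //.
- exact: measurable_gker.
- by apply/measurable_EFinP; exact: measurable_exponential_pdf.
(* The integrands differ at 0, where [pker] vanishes and the density is 1. *)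
exists [set 0]; split => //; first exact: lebesgue_measure_set1.
move=> s /= /not_implyP[_ ns]; apply: contrapT => s0; apply: ns.
have [s0'|s0'] := leP s 0.
  have {}s0' : s < 0 by rewrite lt_neqAle s0' andbT; apply/eqP.
  by rewrite pker_le0 ?ltW// mul0r lt0_exponential_pdf.
by rewrite pkerE// subrr powRr0 mul1r exponential_pdfE ?(ltW s0')// mul1r mulN1r.
Qed.

Lemma rlker1E (t : R) : 0 < t -> rlker 1 t = 1.
Proof. by move=> t0; rewrite rlkerE// Gamma1 subrr powRr0 divr1. Qed.

Variable k : R -> R.
Hypothesis mk : measurable_fun setT k.
Hypothesis k0 : forall s, s <= 0 -> k s = 0.
Hypothesis kex : forall t, convol_ex (rlker 1) k t.

Lemma rlker1_restrict (t : R) :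
  (fun s => rlker 1 (t - s) * k s) = k \_ `]-oo, t[.
Proof.
apply/funext => s; rewrite patchE; case: ifPn => [|].
  by rewrite inE/= in_itv/= => st; rewrite rlker1E ?subr_gt0// mul1r.
rewrite notin_setE/= in_itv/= => /negP; rewrite -leNgt => ts.
by rewrite rlker_le0 ?mul0r// subr_le0.
Qed.

Lemma integrable_ray (y : R) : mu.-integrable `]-oo, y] (EFin \o k).
Proof.
(* Since [rlker 1] vanishes at 0, [kex] reaches open rays only; the ray up to [y + 1] contains the
   endpoint [y]. *)
have : mu.-integrable `]-oo, y + 1[ (EFin \o k).
  apply/(integrable_mkcond _ _).2 => //.
  rewrite restrict_EFin -rlker1_restrict; exact: kex.
apply: integrableS => //; apply: subset_itvl.
by rewrite bnd_simp ltrDl.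
Qed.

Lemma locally_integrable_ray : locally_integrable [set: R] k.
Proof.
split => //; first exact: openT.
move=> K _ cK; have [M [_ MK]] := compact_bounded cK.
have /integrableP[_] := integrable_ray (M + 1).
apply: le_lt_trans; apply: ge0_subset_integral => //.
- exact: compact_measurable.
- by apply: measurable_funTS; apply/measurable_EFinP; apply: measurableT_comp.
- move=> x Kx /=; rewrite in_itv/=; apply: le_trans (ler_norm _) _.
  by apply: MK => //; rewrite ltrDl.
Qed.

Lemma primitiveE (t : R) : convol (rlker 1) k t = \int[mu]_(s in `]-oo, t]) k s.
Proof.
rewrite /convol rlker1_restrict -Rintegral_mkcond Rintegral_itv_bndo_bndc//.
apply: integrableS (integrable_ray t) => //.
by apply: subset_itvl; rewrite bnd_simp.
Qed.

Lemma primitive_ae : {ae mu, forall t, derivable (convol (rlker 1) k) t 1 /\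
  (convol (rlker 1) k)^`()%classic t = k t}.
Proof.
have -> : convol (rlker 1) k = (fun t => \int[mu]_(s in `]-oo, t]) k s).
  by apply/funext => t; exact: primitiveE.
exact: FTC1Ny integrable_ray locally_integrable_ray.
Qed.

Lemma primitive_derivable (t : R) : {for t, continuous k} ->
  derivable (convol (rlker 1) k) t 1 /\ (convol (rlker 1) k)^`()%classic t = k t.
Proof.
have -> : convol (rlker 1) k = (fun t => \int[mu]_(s in `]-oo, t]) k s).
  by apply/funext => s; exact: primitiveE.
move=> ck; apply: (@continuous_FTC1 _ _ _ _ (t + 1)) => //.
- by rewrite ltrDl.
- exact: integrable_ray.
- by rewrite ltNyr.
Qed.

Lemma primitive_le0 (t : R) : t <= 0 -> convol (rlker 1) k t = 0.
Proof.
move=> t0; rewrite /convol /Rintegral integral0_eq// => s _.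
have [s0|s0] := leP s 0; first by rewrite k0// mulr0.
by rewrite rlker_le0 ?mul0r// subr_le0 (le_trans t0 (ltW s0)).
Qed.

Lemma primitive_continuous : continuous (convol (rlker 1) k).
Proof.
(* As [k] vanishes to the left of 0, the integral over []-oo, x]] starts as well at any [a <= 0];
   this choice also leaves [t] inside []a, b[], where integrals over a segment depend continuously
   on their end. *)
move=> t; pose a := Num.min 0 t - 1; pose b := t + 1.
have a0 : a <= 0 by rewrite lerBlDr ge_min; apply/orP; left; lra.
have at_ : a < t by rewrite ltrBlDr gt_min; apply/orP; right; lra.
have ab : a < b by rewrite (lt_trans at_)// /b ltrDl.
have tab : t \in `]a, b[ by rewrite in_itv/= at_ /b ltrDl/=.
have iab : mu.-integrable `[a, b] (EFin \o k).
  apply: integrableS (integrable_ray b) => //.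
  by apply: subset_itv => //; rewrite bnd_simp.
have cP := within_continuous_continuous ab
  (parameterized_integral_continuous (ltW ab) iab) tab.
have E x : a < x -> convol (rlker 1) k x = parameterized_integral mu a x k.
  move=> ax; rewrite primitiveE /parameterized_integral.
  rewrite Rintegral_mkcond [RHS]Rintegral_mkcond; congr Rintegral.
  apply/funext => s; rewrite !patchE !mem_setE !in_itv/=.
  have [sa|//] := ltP s a; case: ifPn => // _.
  by rewrite k0// (le_trans (ltW sa)).
rewrite /continuous_at E//; apply: cvg_trans cP; apply: near_eq_cvg.
by near=> x; rewrite E//; near: x; exact: lt_nbhsr.
Unshelve. all: by end_near. Qed.

End primitive.

(* Kernels of different orders would otherwise be compared by unfolding them. *)
Local Opaque mlker rlker convol.

(** * The candidate, its fractional integrals and its form as a double primitive *)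

Section resolvent.
Context {R : realType}.
Local Notation mu := (@lebesgue_measure R).
Variables (g c x y : R) (phi : R -> R).
Hypothesis g0 : 0 < g.
Hypothesis mphi : measurable_fun setT phi.
Hypothesis iphi : mu.-integrable setT (EFin \o phi).
Hypothesis phi0 : forall s, s <= 0 -> phi s = 0.

(* In the notation of the header, [resolvent b] is
   x e_b + y e_(b+1) + e_(b+1) * phi, [resolvent 1] is u, [velocity] is u' and
   [source] is chi. *)
Definition resolvent (b t : R) : R :=
  x * mlker g c b t + y * mlker g c (b + 1) t + convol (mlker g c (b + 1)) phi t.

Definition source (t : R) : R := phi t + c * resolvent (g - 1) t.

Lemma measurable_resolvent (b : R) : 0 < b -> measurable_fun setT (resolvent b).
Proof.
move=> b0; have b10 : 0 < b + 1 by rewrite addr_gt0.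
apply: measurable_funD; last first.
  by apply: measurable_convol => //; exact: measurable_mlker.
by apply: measurable_funD; apply: measurable_funM => //; exact: measurable_mlker.
Qed.

Lemma resolvent_le0 (b t : R) : t <= 0 -> resolvent b t = 0.
Proof.
move=> t0; rewrite /resolvent !mlker_le0// convol_causal ?mulr0 ?addr0// => s s0.
by rewrite mlker_le0.
Qed.

Lemma rint_convol (a b t : R) : 0 <= a -> 1 <= b ->
  rint_ex a (convol (mlker g c b) phi) t /\
  rint a (convol (mlker g c b) phi) t = convol (mlker g c (a + b)) phi t.
Proof.
move=> + b1; rewrite /rint_ex /rint le0r; case: eqVneq => [-> _|_ /= a0].
  by rewrite add0r.
have b0 : 0 < b by exact: lt_le_trans b1.
have ab1 : 1 <= a + b by rewrite ler_wpDl// ltW.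
by have [h _ _ ->] := convol_rlker_convol g g0 c phi mphi iphi phi0 a b t a0 b0 ab1.
Qed.

Lemma rint_resolvent (a b t : R) : 0 <= a -> 0 < b ->
  rint_ex a (resolvent b) t /\ rint a (resolvent b) t = resolvent (a + b) t.
Proof.
move=> a0 b0; have b10 : 0 < b + 1 by rewrite addr_gt0.
have [e1 r1] := rint_mlker g g0 a c b t a0 b0.
have [e2 r2] := rint_mlker g g0 a c (b + 1) t a0 b10.
have [e3 r3] := rint_convol a (b + 1) t a0 (ler_wpDl (ltW b0) (lexx 1)).
have [xe1 xr1] := rintZ _ _ x _ e1.
have [ye2 yr2] := rintZ _ _ y _ e2.
have [s12 q12] := rintD _ _ _ _ xe1 ye2.
have [s q] := rintD _ _ _ _ s12 e3.
split; first exact: s.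
apply: (etrans q); rewrite /resolvent -(addrA a b 1).
congr (_ + _); last exact: r3.
apply: (etrans q12).
congr (_ + _).
  by apply: (etrans xr1); rewrite r1.
by apply: (etrans yr2); rewrite r2.
Qed.

Lemma convol_ex_rlker (b t : R) : 1 <= b -> convol_ex (rlker b) phi t.
Proof.
move=> b1; have b0 : 0 < b by exact: lt_le_trans b1.
(* Existence is read off from the composition law with [c = 0], the order [b] being split into two
   halves whose sum is at least 1. *)
have b20 : 0 < b / 2 by rewrite divr_gt0.
have bb : 1 <= b / 2 + b / 2 by rewrite -splitr.
have [_ + _ _] := convol_rlker_convol g g0 0 phi mphi iphi phi0 (b / 2) (b / 2) t b20 b20 bb.
by rewrite -splitr mlker0.
Qed.

Lemma convol_rlker1_rlker1 (t : R) :
  convol_ex (rlker 1) (convol (rlker 1) phi) t /\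
  convol (rlker 1) (convol (rlker 1) phi) t = convol (rlker (1 + 1)) phi t.
Proof.
have h2 : (1 : R) <= 1 + 1 by rewrite lerDl.
have [+ _ _] := convol_rlker_convol g g0 0 phi mphi iphi phi0 1 1 t ltr01 ltr01 h2.
by rewrite !mlker0.
Qed.

Lemma rint_source (a t : R) : 1 < g -> 0 <= a -> rint_ex a phi t ->
  rint_ex a source t /\ rint a source t = rint a phi t + c * resolvent (a + (g - 1)) t.
Proof.
move=> g1 a0 ea; have g10 : 0 < g - 1 by rewrite subr_gt0.
have [e r] := rint_resolvent a (g - 1) t a0 g10.
have [ce cr] := rintZ _ _ c _ e.
have [s q] := rintD _ _ _ _ ea ce.
split; first exact: s.
apply: (etrans q); congr (_ + _).
by apply: (etrans cr); rewrite r.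
Qed.

Definition velocity (t : R) : R := y * rlker 1 t + convol (rlker 1) source t.

(** The recursion [mlkerS] is applied to each of the three terms of [resolvent 1]. The heads give
    $xg_1+yg_2+g_2*\phi$; the tails combine to [c] times the resolvent of order [g + 1], which is
    $g_2$ convolved with the second summand of [source]. *)
Lemma resolvent1 (t : R) : 1 < g ->
  convol_ex (rlker 1) velocity t /\
  resolvent 1 t = x * rlker 1 t + convol (rlker 1) velocity t.
Proof.
move=> g1; have n0 : (1 : R) != 0 by rewrite oner_eq0.
have r1E (f : R -> R) : rint 1 f = convol (rlker 1) f by rewrite /rint (negbTE n0).
have Psi : convol (rlker 1) source =
    convol (rlker 1) phi \+ (fun s => c * resolvent (1 + (g - 1)) s).
  apply/funext => s.
  have ephi : rint_ex 1 phi s by move=> _; exact: convol_ex_rlker.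
  by have [_] := rint_source 1 s g1 ler01 ephi; rewrite !r1E.
have [ea ra] := convol_rlker 1 1 t ltr01 ltr01.
have [eb rb] := convol_rlker1_rlker1 t.
have gg : 0 < 1 + (g - 1) by rewrite addrC subrK.
have [ec rc] := rint_resolvent 1 (1 + (g - 1)) t ler01 gg.
rewrite r1E in rc.
have [eya rya] := convol_exZ _ _ y _ ea.
have [ecc rcc] := convol_exZ _ _ c _ (ec n0).
have [ebc rbc] := convol_exD _ _ _ _ eb ecc.
have [eV rV] := convol_exD _ _ _ _ eya ebc.
rewrite /velocity Psi; split; first exact: eV.
have -> : convol (rlker 1) ((fun s => y * rlker 1 s) \+
    (convol (rlker 1) phi \+ (fun s => c * resolvent (1 + (g - 1)) s))) t =
    y * rlker (1 + 1) t + (convol (rlker (1 + 1)) phi t +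
    c * resolvent (1 + (1 + (g - 1))) t).
  apply: (etrans rV); congr (_ + _); first by apply: (etrans rya); rewrite ra.
  apply: (etrans rbc); congr (_ + _); first exact: rb.
  by apply: (etrans rcc); rewrite rc.
rewrite /resolvent.
have key (A1 A2 A3 B1 B2 B3 C1 C2 C3 : R) :
    A1 = B1 + c * C1 -> A2 = B2 + c * C2 -> A3 = B3 + c * C3 ->
    x * A1 + y * A2 + A3 = x * B1 + (y * B2 + (B3 + c * (x * C1 + y * C2 + C3))).
  by move=> -> -> ->; ring.
have two0 : 0 < (1 : R) + 1 by rewrite addr_gt0.
have gE : 1 + (1 + (g - 1)) = g + 1 by ring.
have gE2 : 1 + (1 + (g - 1)) + 1 = g + (1 + 1) by ring.
apply: key.
- by rewrite gE; exact: mlkerS.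
- by rewrite gE2; exact: mlkerS.
have e2 : convol_ex (rlker (1 + 1)) phi t by apply: convol_ex_rlker; rewrite lerDl.
have g11 : 1 <= 1 + (g + 1) by rewrite lerDl addr_ge0// ltW.
have [_ e3 _ _] := convol_rlker_convol g g0 c phi mphi iphi phi0 1 (g + 1) t ltr01
  (addr_gt0 g0 ltr01) g11.
have gE3 : 1 + (g + 1) = g + (1 + 1) by ring.
rewrite gE3 in e3; rewrite gE2 -convolDl//; congr (convol _ phi t).
by apply/funext => s; exact: mlkerS.
Qed.

End resolvent.

(** * Null sets and locality of the derivative *)

Section almost_everywhere.
Context {R : realType}.
Local Notation mu := (@lebesgue_measure R).

Lemma aeS (P Q : R -> Prop) : (forall t, P t -> Q t) ->
  {ae mu, forall t, P t} -> {ae mu, forall t, Q t}.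
Proof. by move=> PQ; apply: filterS; first exact: (ae_filter_ringOfSetsType mu). Qed.

Lemma aeI (P Q : R -> Prop) : {ae mu, forall t, P t} -> {ae mu, forall t, Q t} ->
  {ae mu, forall t, P t /\ Q t}.
Proof. by apply: filterI; exact: (ae_filter_ringOfSetsType mu). Qed.

Lemma ae_neq (u : R) : {ae mu, forall t, t != u}.
Proof.
exists [set u]; split => //; first exact: lebesgue_measure_set1.
by move=> t /= /negP; rewrite negbK => /eqP.
Qed.

Lemma near_eq_derive1 (f h : R -> R) (t : R) : (\near t, f t = h t) ->
  (f^`())%classic t = (h^`())%classic t.
Proof. by move=> fh; rewrite !derive1E; exact: near_eq_derive. Qed.

Lemma derive1_cstD (k : R) (f : R -> R) (t : R) :
  ((fun s => k + f s)^`())%classic t = (f^`())%classic t.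
Proof.
rewrite /derive1 (_ : (fun h => h^-1 *: _) = (fun h => h^-1 *: (f (h + t) - f t)))//.
by apply/funext => h; rewrite opprD addrACA subrr add0r.
Qed.

End almost_everywhere.

(** * Derivatives and initial values of the double primitive *)

Section solution.
Context {R : realType}.
Local Notation mu := (@lebesgue_measure R).
Variables (g c x y : R) (phi : R -> R).
Hypothesis g1 : 1 < g.
Hypothesis mphi : measurable_fun setT phi.
Hypothesis iphi : mu.-integrable setT (EFin \o phi).
Hypothesis phi0 : forall s, s <= 0 -> phi s = 0.

Let g0 : 0 < g. Proof. exact: lt_trans g1. Qed.

Local Notation src := (source g c x y phi).
Local Notation vel := (velocity g c x y phi).
Local Notation Psi := (convol (rlker 1) src).

Lemma measurable_source : measurable_fun setT src.
Proof.
apply: measurable_funD => //; apply: measurable_funM => //.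
by apply: measurable_resolvent => //; rewrite subr_gt0.
Qed.

Lemma source_le0 (t : R) : t <= 0 -> src t = 0.
Proof. by move=> t0; rewrite /source phi0// resolvent_le0// mulr0 addr0. Qed.

Lemma convol_ex_source (t : R) : convol_ex (rlker 1) src t.
Proof.
have ephi : rint_ex 1 phi t.
  by move=> _; exact: (convol_ex_rlker g phi g0 mphi iphi phi0).
have [h _] := rint_source g c x y phi g0 mphi iphi phi0 1 t g1 ler01 ephi.
by apply: h; rewrite oner_eq0.
Qed.

Lemma Psi_continuous : continuous Psi.
Proof.
exact: (primitive_continuous _ source_le0 convol_ex_source).
Qed.

Lemma Psi_ae : {ae mu, forall t, derivable Psi t 1 /\ (Psi^`())%classic t = src t}.
Proof. exact: (primitive_ae _ measurable_source convol_ex_source). Qed.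

Lemma Psi_le0 (t : R) : t <= 0 -> Psi t = 0.
Proof. exact: (primitive_le0 _ source_le0). Qed.

Lemma velocityE (t : R) : 0 < t -> vel t = y + Psi t.
Proof. by move=> t0; rewrite /velocity rlker1E// mulr1. Qed.

Lemma velocity_le0 (t : R) : t <= 0 -> vel t = 0.
Proof. by move=> t0; rewrite /velocity rlker_le0// mulr0 add0r Psi_le0. Qed.

(** The term $yg_1$ gives [vel] a jump of height [y] at 0; to the right of 0 it is constant and
    [Psi] is continuous. *)
Lemma velocity_continuous (t : R) : 0 < t -> {for t, continuous vel}.
Proof.
move=> t0; rewrite /prop_for /continuous_at velocityE//.
apply: (@cvg_trans _ ((fun s => y + Psi s) @ t)).
  by apply: near_eq_cvg; near=> s; rewrite velocityE//; near: s; exact: lt_nbhsr.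
exact: (cvgD (cvg_cst y) (Psi_continuous t)).
Unshelve. all: by end_near. Qed.

Lemma convol_ex_velocity (t : R) : convol_ex (rlker 1) vel t.
Proof. exact: (resolvent1 g c x y phi g0 mphi iphi phi0 t g1).1. Qed.

Local Notation U := (convol (rlker 1) vel).

Lemma resolvent1E (t : R) : 0 < t -> resolvent g c x y phi 1 t = x + U t.
Proof.
move=> t0; rewrite (resolvent1 g c x y phi g0 mphi iphi phi0 t g1).2.
by rewrite rlker1E// mulr1.
Qed.

Lemma U_derivable (t : R) : 0 < t -> derivable U t 1 /\ (U^`())%classic t = vel t.
Proof.
move=> t0; apply: (primitive_derivable _ convol_ex_velocity).
exact: velocity_continuous.
Qed.

Lemma cvg_resolvent1 : resolvent g c x y phi 1 t @[t --> 0^'+] --> x.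
Proof.
have cU : U t @[t --> 0^'+] --> U 0.
  apply: cvg_at_right_filter.
  exact: (primitive_continuous _ velocity_le0 convol_ex_velocity).
have : x + U t @[t --> 0^'+] --> x + U 0 by exact: (cvgD (cvg_cst x) cU).
rewrite (primitive_le0 _ velocity_le0 0 (lexx 0)) addr0.
apply: cvg_trans; apply: near_eq_cvg; near=> t; apply/esym/resolvent1E.
by near: t; exact: nbhs_right_gt.
Unshelve. all: by end_near. Qed.

Lemma cvg_velocity : vel t @[t --> 0^'+] --> y.
Proof.
have cP : Psi t @[t --> 0^'+] --> Psi 0.
  by apply: cvg_at_right_filter; exact: Psi_continuous.
have : y + Psi t @[t --> 0^'+] --> y + Psi 0 by exact: (cvgD (cvg_cst y) cP).
rewrite (Psi_le0 0 (lexx 0)) addr0.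
apply: cvg_trans; apply: near_eq_cvg; near=> t; apply/esym/velocityE.
by near: t; exact: nbhs_right_gt.
Unshelve. all: by end_near. Qed.

(* [Psi] is differentiable only almost everywhere; its total derivative takes a
   junk value elsewhere, but remains Borel measurable. *)
Lemma rint_derive (T b t : R) : 0 <= b -> t < T -> rint_ex b src t ->
  let D := ((Psi^`())%classic \_ (`]0, T[)%classic) in
  rint_ex b D t /\ (b != 0 -> rint b D t = rint b src t).
Proof.
move=> b0 tT eb D; have mD : measurable_fun setT D.
  apply/measurable_restrict => //; apply: measurable_funTS.
  by apply: measurable_derive1; exact: Psi_continuous.
have aeD : ae_eq mu setT (fun s : R => (rlker b (t - s) * D s)%:E)
                         (fun s : R => (rlker b (t - s) * src s)%:E).
  have := Psi_ae; apply: aeS => s /= [_ Ps] _; rewrite /D patchE; case: ifPn => [_|].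
    by rewrite Ps.
  rewrite notin_setE/= in_itv/= => /negP; rewrite negb_and -!leNgt => /orP[s0|Ts].
    by rewrite source_le0.
  by rewrite rlker_le0 ?mul0r// subr_le0 (le_trans (ltW tT)).
have mi : measurable_fun setT (fun s : R => (rlker b (t - s) * D s)%:E).
  apply/measurable_EFinP; apply: measurable_convol_integrand => //.
  exact: measurable_rlker.
split=> [bn0|bn0]; first exact: (ae_eq_integrable _ _ mi aeD (eb bn0)).1.
rewrite /rint (negbTE bn0).
have := (ae_eq_integrable _ _ mi aeD (eb bn0)).2.
rewrite (convol_EFin _ _ _ (eb bn0)) (convol_EFin _ _ _ _); last first.
  exact: (ae_eq_integrable _ _ mi aeD (eb bn0)).1.
by case.
Qed.

End solution.

(** * The forcing term and its Mittag-Leffler integral *)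

Section representation.
Context {R : realType}.
Local Notation mu := (@lebesgue_measure R).
Variables (g b T c x y : R) (eta phi : R -> R).
Hypotheses (g1 : 1 < g) (b0 : 0 <= b).
Hypothesis meta : measurable_fun (`]0, T[)%classic eta.
Hypothesis Lphi : L1 T phi.
Hypothesis etaE :
  {ae mu, forall t, 0 < t < T -> eta t = frac_int b phi t}.

Let g0 : 0 < g. Proof. exact: lt_trans g1. Qed.

(** Cutting at [T] as well makes the function integrable on the line and changes no fractional
    integral at [t < T]. *)
Definition zero_ext : R -> R := phi \_ (`]0, T[)%classic.

Lemma zero_extE (s : R) : 0 < s < T -> zero_ext s = phi s.
Proof. by move=> sT; rewrite /zero_ext patchE mem_set//= in_itv. Qed.

Lemma zero_ext_le0 (s : R) : s <= 0 -> zero_ext s = 0.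
Proof.
move=> s0; rewrite /zero_ext patchE memNset//= in_itv/=; apply/negP.
by rewrite negb_and -!leNgt s0.
Qed.

Lemma integrable_zero_ext : mu.-integrable setT (EFin \o zero_ext).
Proof. by rewrite /zero_ext -restrict_EFin; apply/(integrable_mkcond _ _).1. Qed.

Lemma measurable_zero_ext : measurable_fun setT zero_ext.
Proof. by have /integrableP[/measurable_EFinP] := integrable_zero_ext. Qed.

Lemma ae_rint_ex : {ae mu, forall t, 0 < t < T -> rint_ex b zero_ext t}.
Proof.
rewrite /rint_ex; have [->|bn0] := eqVneq b 0; first exact: aeW.
have bp : 0 < b by rewrite lt0r bn0.
have b1 : 1 <= 1 + b by rewrite lerDl.
(* The outer order 1 raises the sum of the orders to at least 1, and its kernel is positive on all
   of [s < T]: the third clause at time [T] yields the claim. *)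
have [_ _ h _] := convol_rlker_convol g g0 0 zero_ext measurable_zero_ext
  integrable_zero_ext zero_ext_le0 1 b T ltr01 bp b1.
move: h; apply: aeS => t + /andP[_ tT] _ => /(_ tT).
by rewrite mlker0.
Qed.

Lemma ae_eta : {ae mu, forall t, 0 < t < T ->
  rint_ex b zero_ext t /\ eta t = rint b zero_ext t}.
Proof.
have := aeI _ _ etaE ae_rint_ex; apply: aeS => t [+ +] tT => /(_ tT) -> /(_ tT) ex.
split => //; have /andP[t0 tT'] := tT.
apply: (frac_intE _ phi _ _ b0 t0 _ zero_ext_le0 ex).2 => s /andP[s0 st].
by rewrite zero_extE// s0 (le_lt_trans st).
Qed.

Lemma rint_le0 (t : R) : t <= 0 -> rint b zero_ext t = 0.
Proof.
move=> t0; rewrite /rint; case: eqVneq => _; first exact: zero_ext_le0.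
by apply: convol_causal => // s s0; [rewrite rlker_le0|exact: zero_ext_le0].
Qed.

Lemma convol_mlker_rint (t : R) :
  convol (mlker g c g) (rint b zero_ext) t = convol (mlker g c (b + g)) zero_ext t.
Proof.
rewrite /rint; case: eqVneq => [->|bn0] /=; first by rewrite add0r.
have bp : 0 < b by rewrite lt0r bn0.
have bg1 : 1 <= b + g by rewrite ler_wpDl// ltW.
exact: (convol_mlker_rlker g g0 c zero_ext measurable_zero_ext
  integrable_zero_ext zero_ext_le0 b g t bp g0 bg1).2.
Qed.

(** As [eta] occurs only under the integral, its almost everywhere representation gives the identity
    at every [t], including [T]; the kernel of order [g] then absorbs $g_b$ by associativity. *)
Lemma integral_mittag_leffler (t : R) : 0 < t <= T ->
  \int[mu]_(s in `]0, t[) ((t - s) `^ (g - 1) *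
     mittag_leffler g g (c * (t - s) `^ g) * eta s) =
  convol (mlker g c (b + g)) zero_ext t.
Proof.
move=> /andP[t0 tT]; rewrite -convol_mlker_rint.
pose h (s : R) : R := mlker g c g (t - s) * eta s.
have mh : measurable_fun setT (h \_ (`]0, t[)%classic).
  apply/(measurable_restrictT _ _).1 => //.
  apply: measurable_funM.
    apply: measurable_funTS; apply: (measurableT_comp (measurable_mlker g g0 c g g0)).
    exact: measurable_funB.
  apply: measurable_funS meta => //; apply: subset_itvl.
  by rewrite bnd_simp.
have mr : measurable_fun setT (fun s : R => mlker g c g (t - s) * rint b zero_ext s).
  apply: measurable_convol_integrand; first exact: measurable_mlker.
  by apply: measurable_rint; exact: measurable_zero_ext.
transitivity (\int[mu]_s ((h \_ (`]0, t[)%classic) s)).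
  rewrite -Rintegral_mkcond; apply: eq_Rintegral => s.
  rewrite inE/= in_itv/= => /andP[s0 st].
  by rewrite /h mlkerE ?subr_gt0.
rewrite convolE; congr fine; apply: ae_eq_integral => //.
- exact/measurable_EFinP.
- exact/measurable_EFinP.
have := ae_eta; apply: aeS => s hs _; congr EFin.
rewrite patchE; case: ifPn => [|].
  rewrite inE/= in_itv/= => /andP[s0 st].
  have sT : 0 < s < T by rewrite s0 (lt_le_trans st).
  by rewrite /h (hs sT).2.
rewrite notin_setE/= in_itv/= => /negP; rewrite negb_and -!leNgt => /orP[s0|ts].
  by rewrite rint_le0// mulr0.
by rewrite mlker_le0 ?mul0r// subr_le0.
Qed.

End representation.

(** * Verification of the equation and the initial conditions on []0, T]] *)

Theorem lemma2 (R : realType) (gamma delta T c x y : R) (eta : R -> R) :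
  1 < gamma < 2 -> 0 <= delta <= 1 -> 0 < T ->
  frac_int_range (delta * (2 - gamma)) T eta ->
  is_solution gamma delta T c x y eta
    (fun t : R =>
       t `^ (gamma + delta * (2 - gamma) - 2)
         * mittag_leffler gamma (gamma + delta * (2 - gamma) - 1)
             (c * t `^ gamma) * x
       + t `^ (gamma + delta * (2 - gamma) - 1)
         * mittag_leffler gamma (gamma + delta * (2 - gamma))
             (c * t `^ gamma) * y
       + \int[lebesgue_measure]_(s in `]0, t[)
           ((t - s) `^ (gamma - 1)
            * mittag_leffler gamma gamma (c * (t - s) `^ gamma) * eta s)).
Proof.
move=> /andP[g1 g2] /andP[d0 d1] T0 [meta [phi Lphi etaE]].
set w := (X in is_solution _ _ _ _ _ _ _ X).
have g0 : 0 < gamma := lt_trans ltr01 g1.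
have g20 : 0 <= 2 - gamma by rewrite subr_ge0 ltW.
set b := delta * (2 - gamma) in meta etaE w *.
set a := (1 - delta) * (2 - gamma).
have b0 : 0 <= b by rewrite mulr_ge0.
have a0 : 0 <= a by rewrite mulr_ge0// subr_ge0.
have gb0 : 0 < gamma + b by rewrite ltr_wpDr.
have gb10 : 0 < gamma + b - 1 by rewrite subr_gt0 ltr_wpDr.
pose phi0 := zero_ext T phi.
have mphi : measurable_fun setT phi0 := measurable_zero_ext T phi Lphi.
have iphi : lebesgue_measure.-integrable setT (EFin \o phi0) :=
  integrable_zero_ext T phi Lphi.
have phi00 : forall s, s <= 0 -> phi0 s = 0 := zero_ext_le0 T phi.
pose W := resolvent gamma c x y phi0 (gamma + b - 1).
have W0 : forall s, s <= 0 -> W s = 0 by move=> s; exact: resolvent_le0.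
have wE s : 0 < s <= T -> W s = w s.
  move=> sT; have /andP[s0 _] := sT.
  rewrite /w (integral_mittag_leffler gamma b T c eta phi g1 b0 meta Lphi etaE s sT).
  have key (A A' B B' C C' : R) : A = A' -> B = B' -> C = C' ->
      x * A + y * B + C = A' * x + B' * y + C'.
    by move=> -> -> ->; rewrite (mulrC x) (mulrC y).
  apply: key.
  - rewrite (mlkerE gamma g0 (gamma + b - 1) c s gb10 s0).
    by rewrite -[gamma + b - 1 - 1]addrA -opprD.
  - by rewrite subrK; exact: (mlkerE gamma g0 (gamma + b) c s gb0 s0).
  - by rewrite subrK (addrC b).
have fracw t : 0 < t <= T -> frac_int_ex a w t /\
    frac_int a w t = resolvent gamma c x y phi0 1 t.
  move=> /andP[t0 tT].
  have [ex rE] := rint_resolvent gamma c x y phi0 g0 mphi iphi phi00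
    a (gamma + b - 1) t a0 gb10.
  have hW s : 0 < s <= t -> W s = w s.
    by move=> /andP[s0 st]; apply: wE; rewrite s0 (le_trans st tT).
  have [fe fE] := frac_intE a w W t a0 t0 hW W0 ex.
  have a1 : a + (gamma + b - 1) = 1 by rewrite /a /b; ring.
  rewrite a1 in rE.
  by split; [exact: fe|exact: (etrans fE rE)].
pose V := velocity gamma c x y phi0.
pose U := convol (rlker 1) V.
pose Psi := convol (rlker 1) (source gamma c x y phi0).
(* The fractional integral of [w] is identified on []0, T]] only; for [t] in the open interval this
   covers a neighbourhood, which is all that a derivative sees. *)
have near_u t : 0 < t < T -> \near t, x + U t = frac_int a w t.
  move=> /andP[t0 tT]; near=> s.
  have s0 : 0 < s by near: s; exact: lt_nbhsr.
  rewrite (fracw s _).2 ?(resolvent1E gamma c x y phi0 g1 mphi iphi phi00)//.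
  by rewrite s0 ltW//; near: s; exact: lt_nbhsl.
have du t : 0 < t < T -> derivable (frac_int a w) t 1 /\
    ((frac_int a w)^`())%classic t = V t.
  move=> tT; have /andP[t0 _] := tT.
  have [dU UV] := U_derivable gamma c x y phi0 g1 mphi iphi phi00 t t0.
  split.
    apply: (near_eq_derivable (near_u t tT)).
    by apply: derivableD.
  rewrite -(near_eq_derive1 _ _ _ (near_u t tT)).
  by rewrite derive1_cstD.
have near_v t : 0 < t < T -> \near t, y + Psi t = ((frac_int a w)^`())%classic t.
  move=> /andP[t0 tT]; near=> s.
  have s0 : 0 < s by near: s; exact: lt_nbhsr.
  rewrite (du s _).2; first by rewrite /V velocityE.
  by rewrite s0/=; near: s; exact: lt_nbhsl.
have d2u t : 0 < t < T ->
    ((frac_int a w)^`(2))%classic t = (Psi^`())%classic t.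
  move=> tT; rewrite -[LHS]/((((frac_int a w)^`())^`())%classic t).
  by rewrite -(near_eq_derive1 _ _ _ (near_v t tT)) derive1_cstD.
have aePsi := Psi_ae gamma c x y phi0 g1 mphi iphi phi00.
have hilferE t : 0 < t < T -> rint_ex b phi0 t ->
    (Psi^`())%classic t = source gamma c x y phi0 t ->
    frac_int_ex b ((frac_int a w)^`(2))%classic t /\
    hilfer_deriv gamma delta w t = rint b phi0 t + c * w t.
  move=> tT eb Psit; have /andP[t0 tT'] := tT.
  have [es rs] := rint_source gamma c x y phi0 g0 mphi iphi phi00 b t g1 b0 eb.
  have [eD rD] := rint_derive gamma c x y phi0 g1 mphi iphi phi00 T b t b0 tT' es.
  (* Beyond [T] the function [w] involves unknown values of [eta]. The second derivative is replaced
     by [D], which agrees with it on []0, t]] and vanishes outside []0, T[]. *)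
  set D := ((Psi^`())%classic \_ (`]0, T[)%classic) in eD rD.
  have D0 s : s <= 0 -> D s = 0.
    move=> s0; rewrite /D patchE memNset//= in_itv/=; apply/negP.
    by rewrite negb_and -!leNgt s0.
  have DE s : 0 < s < T -> D s = (Psi^`())%classic s.
    by move=> sT; rewrite /D patchE mem_set//= in_itv.
  have hD s : 0 < s <= t -> D s = ((frac_int a w)^`(2))%classic s.
    move=> /andP[s0 st]; have sT : 0 < s < T by rewrite s0 (le_lt_trans st).
    exact: (etrans (DE s sT) (esym (d2u s sT))).
  have [fe fE] := frac_intE b _ D t b0 t0 hD D0 eD.
  (* Order 0 is evaluation at [t], where an identity up to null sets says nothing; there [Psit]
     provides the value at this very point. *)
  have rDs : rint b D t = rint b (source gamma c x y phi0) t.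
    have [bz|/rD//] := eqVneq b 0.
    by rewrite /rint bz eqxx; exact: (etrans (DE t tT) Psit).
  have tT1 : 0 < t <= T by rewrite t0 ltW.
  have gE : b + (gamma - 1) = gamma + b - 1 by ring.
  rewrite gE in rs.
  split; first exact: fe.
  rewrite -(wE t tT1); exact: (etrans fE (etrans rDs rs)).
(* The equation is claimed up to [t = T], whereas [eta] and the derivatives are controlled on the
   open interval; the endpoint goes into the null set. *)
have aeT := ae_neq T.
have ltT t : 0 < t <= T -> t != T -> 0 < t < T.
  by move=> /andP[-> tT] tnT; rewrite lt_neqAle tnT.
have aeEta := ae_eta gamma b T eta phi g1 b0 Lphi etaE.
split.
- by move=> t /andP[t0 tT]; apply: (fracw t _).1; rewrite t0 ltW.
- by move=> t tT; exact: (du t tT).1.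
- have := aeI _ _ aeT (aeI _ _ aePsi aeEta).
  apply: aeS => t [tnT [[dPsi Psit] et]] tT; have tT' := ltT t tT tnT.
  split; last by have [h _] := hilferE t tT' (et tT').1 Psit.
  apply: (near_eq_derivable (near_v t tT')).
  by apply: derivableD.
- have := aeI _ _ aeT (aeI _ _ aePsi aeEta).
  apply: aeS => t [tnT [[dPsi Psit] et]] tT; have tT' := ltT t tT tnT.
  have [et1 et2] := et tT'.
  by rewrite (hilferE t tT' et1 Psit).2 et2 addrC.
- have := cvg_resolvent1 gamma c x y phi0 g1 mphi iphi phi00.
  apply: cvg_trans; apply: near_eq_cvg; near=> t.
  rewrite (fracw t _).2//; apply/andP; split; near: t.
    exact: nbhs_right_gt.
  exact: nbhs_right_le.
- have := cvg_velocity gamma c x y phi0 g1 mphi iphi phi00.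
  apply: cvg_trans; apply: near_eq_cvg; near=> t.
  rewrite (du t _).2//; apply/andP; split; near: t.
    exact: nbhs_right_gt.
  exact: nbhs_right_lt.
Unshelve. all: by end_near. Qed.
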